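(* Let $K$ be an infinite field and let $I$ be a homogeneous ideal of the standard graded polynomial ring $R=K[x_1,\ldots,x_n]$. Let $\mathrm{Gin}(I)$ be the generic initial ideal of $I$ with respect to the graded reverse lexicographic order induced by $x_1>\cdots>x_n$. Assume that $\mathrm{Gin}(I)$ is stable. Then $I$ is completely $\mathfrak m$-full if and only if $I$ is componentwise linear.
   Context: A statement holds for a general linear form $x$ if it holds for all $x$ in some nonempty Zariski open subset of the $K$-vector space $R_1$ of linear forms. Completely $\mathfrak m$-full ideals are homogeneous ideals of polynomial rings $R=K[x_1,\ldots,x_n]$ with homogeneous maximal ideal $\mathfrak m=(x_1,\ldots,x_n)$, defined recursively: (1) if $n=0$ (i.e. if $R$ is a field), the zero ideal is completely $\mathfrak m$-full; (2) if $n>0$, $I$ is completely $\mathfrak m$-full if $\mathfrak m I:x=I$ and $(I+xR)/xR$ is completely $\mathfrak m$-full as an ideal of $R/xR$ (a polynomial ring in $n-1$ variables), where $x$ is a general linear form. A homogeneous ideal $I$ is componentwise linear if for every $d$ the ideal $I_{\langle d\rangle}$ generated by all homogeneous polynomials of degree $d$ belonging to $I$ has a linear resolution, i.e. $\mathrm{Tor}^R_i(I_{\langle d\rangle},K)_{i+j}=0$ for all $i$ and all $j\ne d$ (the zero ideal is regarded as having a linear resolution). A monomial ideal $J$ of $R$ is stable if for each monomial $u\in J$ the monomial $x_iu/x_{m(u)}$ belongs to $J$ for every $i<m(u)$, where $m(u)$ is the largest index $j$ such that $x_j$ divides $u$. $\mathrm{Gin}(I)$ is the initial ideal of $g(I)$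 for $g$ in a suitable nonempty Zariski open subset of $GL_n(K)$ acting by linear changes of coordinates (it is constant on such a subset).
   Formalization: The ideal I is assumed proper: for I = R the statement fails, since R is componentwise linear with stable Gin(R) = R but is not completely m-full, as the recursion ends at n = 0 with only the zero ideal. *)

(* Defs.v *)
From HB Require Import structures.
From mathcomp Require Import all_boot all_order all_algebra.
From mathcomp.multinomials Require Export mpoly.

Set Implicit Arguments.
Unset Strict Implicit.
Unset Printing Implicit Defensive.

Import GRing.Theory.
Local Open Scope ring_scope.

Definition infinite_field (K : fieldType) : Prop :=
  forall s : seq K, exists x : K, x \notin s.

(* Ideals are Prop-valued predicates, since membership in the ideals built below
   is not given by a boolean test. *)

Record is_ideal (K : fieldType) (n : nat) (I : {mpoly K[n]} -> Prop) : Prop :=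
  IsIdeal {
    ideal_zero : I 0;
    ideal_add : forall f g, I f -> I g -> I (f + g);
    ideal_mull : forall a f, I f -> I (a * f)
  }.

Definition same_ideal (K : fieldType) (n : nat)
    (I J : {mpoly K[n]} -> Prop) : Prop :=
  forall f, I f <-> J f.

Definition ideal_gen (K : fieldType) (n : nat) (S : {mpoly K[n]} -> Prop) :
    {mpoly K[n]} -> Prop :=
  fun f => exists (r : nat) (a s : 'I_r -> {mpoly K[n]}),
    (forall i, S (s i)) /\ f = \sum_(i < r) a i * s i.

Definition homogeneous_ideal (K : fieldType) (n : nat)
    (I : {mpoly K[n]} -> Prop) : Prop :=
  is_ideal I /\ forall f d, I f -> I (pihomog mdeg d f).

Definition ideal_mul (K : fieldType) (n : nat) (I J : {mpoly K[n]} -> Prop) :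
    {mpoly K[n]} -> Prop :=
  ideal_gen (fun p => exists f g, [/\ I f, J g & p = f * g]).

Definition ideal_colon (K : fieldType) (n : nat) (I : {mpoly K[n]} -> Prop)
    (x : {mpoly K[n]}) : {mpoly K[n]} -> Prop :=
  fun f => I (f * x).

Definition max_ideal (K : fieldType) (n : nat) : {mpoly K[n]} -> Prop :=
  ideal_gen (fun p => exists i : 'I_n, p = 'X_i).

Definition zariski_open (K : fieldType) (m : nat) (U : 'rV[K]_m -> Prop) : Prop :=
  exists S : {mpoly K[m]} -> Prop,
    forall v, U v <-> exists2 p, S p & p.@[fun i => v 0 i] != 0.

Definition zariski_open_GL (K : fieldType) (n : nat) (V : 'M[K]_n -> Prop) :
    Prop :=
  exists U : 'rV[K]_(n * n) -> Prop, zariski_open U /\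
    forall g, V g <-> (g \in unitmx) /\ U (mxvec g).

Definition linear_form (K : fieldType) (n : nat) (c : 'rV[K]_n) : {mpoly K[n]} :=
  \sum_(i < n) c 0 i *: 'X_i.

Definition for_general_linear_form (K : fieldType) (n : nat)
    (P : {mpoly K[n]} -> Prop) : Prop :=
  exists U : 'rV[K]_n -> Prop,
    [/\ zariski_open U, exists c, U c & forall c, U c -> P (linear_form c)].

(* The K-algebra homomorphism sending the i-th variable to the linear form whose
   coefficients are the i-th row of A. *)
Definition linear_subst (K : fieldType) (n m : nat) (A : 'M[K]_(n, m))
    (f : {mpoly K[n]}) : {mpoly K[m]} :=
  f \mPo [tuple linear_form (row i A) | i < n].

Definition ideal_image (K : fieldType) (n m : nat) (A : 'M[K]_(n, m))
    (I : {mpoly K[n]} -> Prop) : {mpoly K[m]} -> Prop :=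
  fun h => exists2 f, I f & h = linear_subst A f.

(* linear_subst A induces a graded isomorphism from R/xR, where R = K[x_1..x_n],
   onto the polynomial ring in m variables; x = 0 is excluded when m < n. *)
Definition presents_quotient (K : fieldType) (n m : nat) (x : {mpoly K[n]})
    (A : 'M[K]_(n, m)) : Prop :=
  (forall h, exists f, linear_subst A f = h) /\
  (forall f, linear_subst A f = 0 <-> exists a, f = a * x).

(* R/xR is identified with a polynomial ring in one variable less by a choice of
   linear coordinates A; the ideal (I + xR)/xR then becomes ideal_image A I.
   Being completely m-full is invariant under linear changes of coordinates, so
   the choice of A is immaterial. *)
Fixpoint completely_m_full (K : fieldType) (n : nat) :
    ({mpoly K[n]} -> Prop) -> Prop :=
  match n with
  | 0 => fun I => forall f, I f <-> f = 0
  | n'.+1 => fun I => for_general_linear_form (fun x =>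
      same_ideal (ideal_colon (ideal_mul (@max_ideal K n'.+1) I) x) I /\
      exists A : 'M[K]_(n'.+1, n'),
        presents_quotient x A /\ completely_m_full (ideal_image A I))
  end.

(* A sequence of graded free modules F_i = R^(fr_rank i), whose a-th basis vector
   has degree fr_deg i a. Elements are row vectors and maps act by right
   multiplication. *)
Record free_complex (K : fieldType) (n : nat) := FreeComplex {
  fr_rank : nat -> nat;
  fr_deg : forall i, 'I_(fr_rank i) -> int;
  fr_aug : 'cV[{mpoly K[n]}]_(fr_rank 0);
  fr_diff : forall i, 'M[{mpoly K[n]}]_(fr_rank i.+1, fr_rank i)
}.

(* ... -> F_1 -> F_0 -> I -> 0 is exact with homogeneous maps of degree 0. *)
Record is_free_resolution (K : fieldType) (n : nat) (F : free_complex K n)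
    (I : {mpoly K[n]} -> Prop) : Prop := IsFreeResolution {
  fr_aug_homog : forall a m, m \in msupp (fr_aug F a 0) ->
    (mdeg m)%:Z = fr_deg a;
  fr_diff_homog : forall i a b m, m \in msupp (fr_diff F i a b) ->
    (mdeg m)%:Z + fr_deg b = fr_deg a;
  fr_aug_image : forall f, I f <-> exists v : 'rV_(fr_rank F 0), f = (v *m fr_aug F) 0 0;
  fr_exact0 : forall v : 'rV_(fr_rank F 0), v *m fr_aug F = 0 <->
    exists w, v = w *m fr_diff F 0;
  fr_exactS : forall i (v : 'rV_(fr_rank F i.+1)), v *m fr_diff F i = 0 <->
    exists w, v = w *m fr_diff F i.+1
}.

(* The differential F_(i+1) (x) K -> F_i (x) K, with K = R/m: reduction modulo m
   takes constant terms. *)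
Definition fr_diffK (K : fieldType) (n : nat) (F : free_complex K n) (i : nat) :
    'M[K]_(fr_rank F i.+1, fr_rank F i) :=
  map_mx (fun p : {mpoly K[n]} => p@_0%MM) (fr_diff F i).

Definition fr_cycleK (K : fieldType) (n : nat) (F : free_complex K n) (i : nat) :
    'rV[K]_(fr_rank F i) -> Prop :=
  match i with
  | 0 => fun _ => True
  | i'.+1 => fun v => v *m fr_diffK F i' = 0
  end.

Definition fr_in_degree (K : fieldType) (n : nat) (F : free_complex K n)
    (i : nat) (k : int) (v : 'rV[K]_(fr_rank F i)) : Prop :=
  forall a, v 0 a != 0 -> fr_deg a = k.

(* H_i(F (x) K)_k = 0 *)
Definition tor_vanishes (K : fieldType) (n : nat) (F : free_complex K n)
    (i : nat) (k : int) : Prop :=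
  forall v : 'rV[K]_(fr_rank F i), fr_in_degree k v -> fr_cycleK v ->
    exists2 w : 'rV[K]_(fr_rank F i.+1),
      fr_in_degree k w & v = w *m fr_diffK F i.

(* Tor_i(I, K)_(i+j) = 0 for all i and all j <> d. Tor is computed from a graded
   free resolution of I and does not depend on which one is used. *)
Definition linear_resolution (K : fieldType) (n : nat)
    (I : {mpoly K[n]} -> Prop) (d : nat) : Prop :=
  exists2 F : free_complex K n, is_free_resolution F I &
    forall (i : nat) (j : int), j <> d%:Z -> tor_vanishes F i (i%:Z + j).

Definition ideal_component (K : fieldType) (n : nat) (I : {mpoly K[n]} -> Prop)
    (d : nat) : {mpoly K[n]} -> Prop :=
  ideal_gen (fun f => I f /\ f \is d.-homog).

Definition componentwise_linear (K : fieldType) (n : nat)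
    (I : {mpoly K[n]} -> Prop) : Prop :=
  forall d : nat, linear_resolution (ideal_component I d) d.

(* Graded reverse lexicographic order with x_1 > ... > x_n. The order of the
   library on 'X_{1..n}, used by mlead, is the graded lexicographic one. *)
Definition grevlex_lt (n : nat) (u v : 'X_{1..n}) : Prop :=
  (mdeg u < mdeg v)%N \/
  (mdeg u = mdeg v /\ exists i : 'I_n, (v i < u i)%N /\
     forall j : 'I_n, (i < j)%N -> u j = v j).

Definition is_initial (K : fieldType) (n : nat) (f : {mpoly K[n]})
    (u : 'X_{1..n}) : Prop :=
  u \in msupp f /\ forall v, v \in msupp f -> v != u -> grevlex_lt v u.

Definition initial_ideal (K : fieldType) (n : nat) (I : {mpoly K[n]} -> Prop) :
    {mpoly K[n]} -> Prop :=
  ideal_gen (fun p => exists f u, [/\ I f, is_initial f u & p = 'X_[u]]).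

Definition is_gin (K : fieldType) (n : nat) (I J : {mpoly K[n]} -> Prop) : Prop :=
  exists V : 'M[K]_n -> Prop,
    [/\ zariski_open_GL V, exists g, V g &
        forall g, V g -> same_ideal (initial_ideal (ideal_image g I)) J].

Definition monomial_ideal (K : fieldType) (n : nat) (J : {mpoly K[n]} -> Prop) :
    Prop :=
  exists S : 'X_{1..n} -> Prop,
    same_ideal J (ideal_gen (fun p => exists2 u, S u & p = 'X_[u])).

(* j = m(u) *)
Definition is_max_var (n : nat) (u : 'X_{1..n}) (j : 'I_n) : Prop :=
  (0 < u j)%N /\ forall k : 'I_n, (j < k)%N -> u k = 0%N.

Definition stable_ideal (K : fieldType) (n : nat) (J : {mpoly K[n]} -> Prop) :
    Prop :=
  monomial_ideal J /\
  forall (u : 'X_{1..n}) (j : 'I_n), J 'X_[u] -> is_max_var u j ->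
    forall i : 'I_n, (i < j)%N -> J 'X_[((u - U_(j)) + U_(i))%MM].

(* Main.v *)
From HB Require Import structures.
Require Import Defs.
From Stdlib Require Import ClassicalEpsilon FunctionalExtensionality.
From mathcomp Require Import all_boot all_order all_algebra zify ring.

(** A graded module M is e-linear when it is generated in degree e and its
    syzygies, iterated as often as one likes, are generated in the next degree.
    This notion is invariant under division by a regular variable, and, in a
    short exact sequence whose kernel is e-linear, it passes from the middle term
    to the quotient and back; by induction on the number of variables every module
    concentrated in degree e is e-linear, and an e-linear module has no socle above
    degree e.

    Let J = I_<d> and let x be a linear form. As x is regular on J, d-linearity of
    J over R is that of J/xJ over R/xR, which is an extension of the image of J in
    R/xR by N = (J : x)/J shifted by one. If mI : x = I and the image of J is
    d-linear, then N vanishes above degree d - 1, so that J is d-linear. If J is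
    d-linear and x is general, then N has finite length, the socle bound confines
    it to degree d - 1, and the image of J is d-linear. The ideals I_<d> with d
    large are truncations of one another, so that finitely many conditions on x
    suffice. Induction on the number of variables concludes. *)

Set Implicit Arguments.
Unset Strict Implicit.
Unset Printing Implicit Defensive.

Import Order.TTheory GRing.Theory.
Local Open Scope ring_scope.

(** The definition of [linear_resolution] speaks of some graded free resolution, not necessarily
    minimal, and using it directly would call for long exact sequences and the invariance of Tor.
    Iterated syzygies of the lowest graded piece replace both. The map from R tensor M_e to M can be
    formed with combinations of monomials having values in M_e, so additive groups with commuting
    operators suffice, and K returns only where bases are chosen. The two notions meet because mI
    and I_<d> agree in degree d + 1. Hence mI : x = I says, one degree at a time, that a form f of
    degree d with x f in I_<d> lies in I. This controls N in a single degree; linearity of the image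
    is what carries it upwards. That N has finite length for general x is usually seen by avoiding
    associated primes. Noetherian induction on J produces the open condition without any
    decomposition of J. Properness is essential: the unit ideal is componentwise linear, but once
    all variables are cut only the zero ideal is completely m-full. *)

Lemma fun_choice (A B : Type) (P : A -> B -> Prop) :
  (forall a, exists b, P a b) -> exists f : A -> B, forall a, P a (f a).
Proof.
move=> H; exists (fun a => proj1_sig (constructive_indefinite_description _ (H a))).
by move=> a; exact: proj2_sig.
Qed.

(** * Functions on monomials *)

Definition mfun (n : nat) (V : Type) := 'X_{1..n} -> V.

Section MfunZmodule.
Variables (n : nat) (V : zmodType).
Implicit Types f g : mfun n V.

(** A [zmodType] carries decidable equality and a choice operator; for functions on monomials both
    are taken from classical logic. *)
Definition mfun_eqb f g := if excluded_middle_informative (f = g) then true else false.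

Lemma mfun_eqP : Equality.axiom mfun_eqb.
Proof. by move=> f g; rewrite /mfun_eqb; case: excluded_middle_informative => h; constructor. Qed.

HB.instance Definition _ := hasDecEq.Build (mfun n V) mfun_eqP.

Definition mfun_find (P : pred (mfun n V)) (k : nat) : option (mfun n V) :=
  match excluded_middle_informative (exists f, P f) with
  | left h => Some (proj1_sig (constructive_indefinite_description _ h))
  | right _ => None
  end.

Lemma mfun_find_correct P k f : mfun_find P k = Some f -> P f.
Proof.
rewrite /mfun_find; case: excluded_middle_informative => // h [<-].
exact: (proj2_sig (constructive_indefinite_description _ h)).
Qed.

Lemma mfun_find_complete (P : pred (mfun n V)) : (exists f, P f) -> exists k, mfun_find P k.
Proof. by move=> h; exists 0%N; rewrite /mfun_find; case: excluded_middle_informative. Qed.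

Lemma mfun_find_ext (P Q : pred (mfun n V)) : P =1 Q -> mfun_find P =1 mfun_find Q.
Proof. by move=> /functional_extensionality ->. Qed.

HB.instance Definition _ := hasChoice.Build (mfun n V)
  mfun_find_correct mfun_find_complete mfun_find_ext.

Definition mfun_zero : mfun n V := fun _ => 0.
Definition mfun_opp f : mfun n V := fun u => - f u.
Definition mfun_add f g : mfun n V := fun u => f u + g u.

Lemma mfun_addA : associative mfun_add.
Proof. by move=> f g h; apply: functional_extensionality => u; exact: addrA. Qed.
Lemma mfun_addC : commutative mfun_add.
Proof. by move=> f g; apply: functional_extensionality => u; exact: addrC. Qed.
Lemma mfun_add0 : left_id mfun_zero mfun_add.
Proof. by move=> f; apply: functional_extensionality => u; exact: add0r. Qed.
Lemma mfun_addN : left_inverse mfun_zero mfun_opp mfun_add.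
Proof. by move=> f; apply: functional_extensionality => u; exact: addNr. Qed.

HB.instance Definition _ := GRing.isZmodule.Build (mfun n V)
  mfun_addA mfun_addC mfun_add0 mfun_addN.

Lemma mfunB f g u : (f - g) u = f u - g u. Proof. by []. Qed.
Lemma mfunD f g u : (f + g) u = f u + g u. Proof. by []. Qed.
(** A finitely supported [f] stands for the sum of the x^u tensor [f u]; this is multiplication by
    the variable of index [i]. *)
Definition mfunX (i : 'I_n) f : mfun n V :=
  fun u => if (0 < u i)%N then f (u - U_(i))%MM else 0.

Lemma mfunX_sub i f g : mfunX i (f - g) = mfunX i f - mfunX i g.
Proof.
by apply: functional_extensionality => u; rewrite mfunB /mfunX; case: ifP; rewrite ?subr0.
Qed.

Lemma mfunX_add1 i f u : mfunX i f (u + U_(i))%MM = f u.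
Proof. by rewrite /mfunX mnmDE mnm1E eqxx addn1 /= addmK. Qed.

Lemma mfunX_comm i j f : mfunX i (mfunX j f) = mfunX j (mfunX i f).
Proof.
apply: functional_extensionality => u; rewrite /mfunX !mnmBE !mnm1E.
have [->|ne] := eqVneq i j; first by [].
rewrite !subn0 !submDA [(U_(j) + _)%MM]addmC.
by do 2!case: ifP.
Qed.

End MfunZmodule.

Lemma mnm_add1_ind n (P : 'X_{1..n} -> Prop) :
  P 0%MM -> (forall u i, P u -> P (u + U_(i))%MM) -> forall u, P u.
Proof.
move=> P0 PS u; elim: {u}(mdeg u) {-2}u (erefl (mdeg u)) => [|d IH] u.
  by move/eqP; rewrite mdeg_eq0 => /eqP ->.
move=> du; have [i ui] : exists i, u i != 0%N.
  apply/existsP; apply: contra_eqT du => /existsPn h.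
  by rewrite (_ : u = 0%MM) ?mdeg0 //; apply/mnmP => i; rewrite mnm0E; have /negbNE/eqP := h i.
have le : (U_(i) <= u)%MM by rewrite lep1mP.
rewrite -(submK le); apply: PS; apply: IH.
by apply/eqP; rewrite -eqSS -du -{2}(submK le) mdegD mdeg1 addn1.
Qed.

Definition mons (n j : nat) : seq 'X_{1..n} :=
  [seq u <- map val (enum {: 'X_{1..n < j.+1}}) | mdeg u == j].

Lemma mem_mons n j (u : 'X_{1..n}) : (u \in mons n j) = (mdeg u == j).
Proof.
rewrite mem_filter; case: eqP => //= du; apply/mapP.
by exists (@BMultinom n j.+1 u (eq_leq (congr1 S du))); rewrite ?mem_enum.
Qed.

Lemma uniq_mons n j : uniq (mons n j).
Proof. by rewrite filter_uniq // map_inj_uniq ?enum_uniq //; apply: val_inj. Qed.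

(** * Graded modules presented as subquotients *)

(* The module with graded pieces gm_Z k / gm_B k over a polynomial ring in n
   variables acting by gm_X; scalars play no role. *)
Record gmod_axioms (n : nat) (V : zmodType) (X : 'I_n -> V -> V)
    (Z B : nat -> V -> Prop) : Prop := GmodAxioms {
  gmX_sub : forall i u v, X i (u - v) = X i u - X i v;
  gmX_comm : forall i j v, X i (X j v) = X j (X i v);
  gmB_0 : forall k, B k 0;
  gmB_sub : forall k u v, B k u -> B k v -> B k (u - v);
  gmB_X : forall k i v, B k v -> B k.+1 (X i v);
  gmZ_sub : forall k u v, Z k u -> Z k v -> Z k (u - v);
  gmZ_X : forall k i v, Z k v -> Z k.+1 (X i v);
  gmBZ : forall k v, B k v -> Z k v }.

Record gmodule (n : nat) := Gmodule {
  gm_sort :> zmodType;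
  gm_X : 'I_n -> gm_sort -> gm_sort;
  gm_Z : nat -> gm_sort -> Prop;
  gm_B : nat -> gm_sort -> Prop;
  gm_ax : gmod_axioms gm_X gm_Z gm_B }.
Arguments gm_X {n} g i v.
Arguments gm_Z {n} g k v.
Arguments gm_B {n} g k v.

(** * Additive maps and subgroups in terms of subtraction *)

Section Additive.
Variables (U V : zmodType) (h : U -> V).
Hypothesis h_sub : forall u v, h (u - v) = h u - h v.

Lemma sub_morph0 : h 0 = 0.
Proof. by rewrite -(subrr (0 : U)) h_sub subrr. Qed.
Lemma sub_morphN u : h (- u) = - h u.
Proof. by rewrite -sub0r h_sub sub_morph0 sub0r. Qed.
Lemma sub_morphD u v : h (u + v) = h u + h v.
Proof. by rewrite -{1}(opprK v) h_sub sub_morphN opprK. Qed.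
Lemma sub_morph_sum (T : Type) (r : seq T) (P : pred T) (F : T -> U) :
  h (\sum_(t <- r | P t) F t) = \sum_(t <- r | P t) h (F t).
Proof. by elim/big_ind2: _ => [|u1 v1 u2 v2 <- <-|//]; [exact: sub_morph0|exact: sub_morphD]. Qed.
End Additive.

Section Closed.
Variables (V : zmodType) (S : V -> Prop).
Hypothesis S0 : S 0.
Hypothesis S_sub : forall u v, S u -> S v -> S (u - v).

Lemma sub_closedN u : S u -> S (- u).
Proof. by move=> Su; rewrite -sub0r; exact: S_sub. Qed.
Lemma sub_closedD u v : S u -> S v -> S (u + v).
Proof. by move=> Su Sv; rewrite -(opprK v); apply: S_sub => //; exact: sub_closedN. Qed.
Lemma sub_closed_sum (T : eqType) (r : seq T) (F : T -> V) :
  (forall t, t \in r -> S (F t)) -> S (\sum_(t <- r) F t).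
Proof. by move=> H; rewrite big_seq; elim/big_ind: _ => // u v; exact: sub_closedD. Qed.
End Closed.

(** * Monomial action and syzygies of a graded module *)

Section GmodTheory.
Variables (n : nat) (M : gmodule n).
Local Notation X := (gm_X M).
Local Notation Z := (gm_Z M).
Local Notation B := (gm_B M).

Lemma gX_sub i u v : X i (u - v) = X i u - X i v. Proof. exact: (gmX_sub (gm_ax M)). Qed.
Lemma gX0 i : X i 0 = 0. Proof. exact: (sub_morph0 (gX_sub i)). Qed.
Lemma gX_comm i j v : X i (X j v) = X j (X i v). Proof. exact: (gmX_comm (gm_ax M)). Qed.
Lemma gB0 k : B k 0. Proof. exact: (gmB_0 (gm_ax M)). Qed.
Lemma gBZ k v : B k v -> Z k v. Proof. exact: (gmBZ (gm_ax M)). Qed.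
Lemma gZ0 k : Z k 0. Proof. exact/gBZ/gB0. Qed.
Lemma gB_sub k u v : B k u -> B k v -> B k (u - v). Proof. exact: (gmB_sub (gm_ax M)). Qed.
Lemma gZ_sub k u v : Z k u -> Z k v -> Z k (u - v). Proof. exact: (gmZ_sub (gm_ax M)). Qed.
Lemma gB_X k i v : B k v -> B k.+1 (X i v). Proof. exact: (gmB_X (gm_ax M)). Qed.
Lemma gZ_X k i v : Z k v -> Z k.+1 (X i v). Proof. exact: (gmZ_X (gm_ax M)). Qed.
Definition gBD k := sub_closedD (gB0 k) (@gB_sub k).
Definition gBN k := sub_closedN (gB0 k) (@gB_sub k).
Definition gZD k := sub_closedD (gZ0 k) (@gZ_sub k).
Definition gZN k := sub_closedN (gZ0 k) (@gZ_sub k).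
Definition gB_sum k := sub_closed_sum (gB0 k) (@gB_sub k).
Definition gZ_sum k := sub_closed_sum (gZ0 k) (@gZ_sub k).

Lemma gB_congr k u v : B k (u - v) -> B k u <-> B k v.
Proof.
move=> h; split=> h'; last by rewrite -(subrK v u); exact: gBD.
by rewrite -(subKr u v); exact: gB_sub.
Qed.

Definition mact (u : 'X_{1..n}) (v : M) : M :=
  foldr (fun i w => iter (u i) (X i) w) v (enum 'I_n).

Lemma iterX_comm a i b j v : iter a (X i) (iter b (X j) v) = iter b (X j) (iter a (X i) v).
Proof.
have h w : X i (iter b (X j) w) = iter b (X j) (X i w).
  by elim: b => //= b IH; rewrite gX_comm IH.
by elim: a => //= a ->; rewrite h.
Qed.

Lemma mact0 v : mact 0%MM v = v.
Proof. by rewrite /mact; elim: (enum _) => //= i s ->; rewrite mnm0E. Qed.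

Lemma mact_add1 u i v : mact (u + U_(i))%MM v = X i (mact u v).
Proof.
rewrite /mact; have: i \in enum 'I_n by rewrite mem_enum.
elim: (enum _) (enum_uniq 'I_n) => //= j s IH /andP[js us].
rewrite inE mnmDE mnm1E; have [eij _|ne /= si] := eqVneq i j.
  subst j; rewrite addn1 /=; congr (X i (iter _ _ _)).
  elim: s js {IH us} => //= l s IH; rewrite inE negb_or => /andP[ne /IH ->].
  by rewrite mnmDE mnm1E (negbTE ne) addn0.
by rewrite addn0 IH // -/(iter 1 (X i) _) iterX_comm.
Qed.

Lemma mact_sub u v w : mact u (v - w) = mact u v - mact u w.
Proof. by elim/mnm_add1_ind: u => [|u i IH]; rewrite ?mact0 // !mact_add1 IH gX_sub. Qed.

Lemma mactX u i v : mact u (X i v) = X i (mact u v).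
Proof. by elim/mnm_add1_ind: u => [|u j IH]; rewrite ?mact0 // !mact_add1 IH gX_comm. Qed.

Lemma mactB k u v : B k v -> B (k + mdeg u) (mact u v).
Proof.
move=> Bv; elim/mnm_add1_ind: u => [|u i IH]; rewrite ?mact0 ?mdeg0 ?addn0 //.
by rewrite mact_add1 mdegD mdeg1 addn1 addnS; exact: gB_X.
Qed.

Lemma mactZ k u v : Z k v -> Z (k + mdeg u) (mact u v).
Proof.
move=> Zv; elim/mnm_add1_ind: u => [|u i IH]; rewrite ?mact0 ?mdeg0 ?addn0 //.
by rewrite mact_add1 mdegD mdeg1 addn1 addnS; exact: gZ_X.
Qed.

(** The multiplication map from R_j tensor M_e to M_(e+j); its kernel is the degree [j] part of the
    syzygies. *)
Definition gev (j : nat) (f : mfun n M) : M := \sum_(u <- mons n j) mact u (f u).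

Lemma gev_sub j f g : gev j (f - g) = gev j f - gev j g.
Proof. by rewrite /gev -sumrB; apply: eq_bigr => u _; rewrite mfunB mact_sub. Qed.

Lemma gevX j i f : gev j.+1 (mfunX i f) = X i (gev j f).
Proof.
rewrite /gev (sub_morph_sum (gX_sub i)) (bigID (fun u : 'X_{1..n} => (0 < u i)%N)) /=.
rewrite [X in _ + X]big1_seq ?addr0; last first.
  by move=> u /andP[h _]; rewrite /mfunX (negbTE h) (sub_morph0 (mact_sub u)).
rewrite -big_filter (perm_big (map (fun u => (u + U_(i))%MM) (mons n j))) /=.
  by rewrite big_map; apply: eq_bigr => u _; rewrite mfunX_add1 mact_add1.
apply: uniq_perm => [||u].
- by rewrite filter_uniq ?uniq_mons.
- by rewrite map_inj_uniq ?uniq_mons //; exact: addIm.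
rewrite mem_filter mem_mons; apply/andP/mapP => [[ui /eqP du]|[w]].
  have le : (U_(i) <= u)%MM by rewrite lep1mP -lt0n.
  exists (u - U_(i))%MM; last by rewrite submK.
  by rewrite mem_mons -eqSS -du -{2}(submK le) mdegD mdeg1 addn1.
by rewrite mem_mons => /eqP dw ->; rewrite mnmDE mnm1E eqxx mdegD mdeg1 dw !addn1.
Qed.

Lemma gev0 f : gev 0 f = f 0%MM.
Proof.
rewrite /gev (perm_big [:: 0%MM]) ?big_seq1 ?mact0 //.
by apply: uniq_perm; rewrite ?uniq_mons // => u; rewrite mem_mons inE mdeg_eq0.
Qed.

Definition msupported (j : nat) (f : mfun n M) := forall u, mdeg u <> j -> f u = 0.
Definition mvalued (S : M -> Prop) (f : mfun n M) := forall u, S (f u).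

Lemma msupportedX j i f : msupported j f -> msupported j.+1 (mfunX i f).
Proof.
move=> h u du; rewrite /mfunX; case: ifP => // ui; apply: h => du'; apply: du.
have le : (U_(i) <= u)%MM by rewrite lep1mP -lt0n.
by rewrite -(submK le) mdegD mdeg1 du' addn1.
Qed.

Lemma gev_B e j f : mvalued (B e) f -> B (e + j) (gev j f).
Proof. by move=> h; apply: gB_sum => u; rewrite mem_mons => /eqP <-; exact: mactB. Qed.

Lemma gev_Z e j f : mvalued (Z e) f -> Z (e + j) (gev j f).
Proof. by move=> h; apply: gZ_sum => u; rewrite mem_mons => /eqP <-; exact: mactZ. Qed.

Lemma mvaluedX (S : M -> Prop) i f : S 0 -> mvalued S f -> mvalued S (mfunX i f).
Proof. by move=> S0 h u; rewrite /mfunX; case: ifP. Qed.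

Definition gen_in (e : nat) : Prop :=
  (forall k v, (k < e)%N -> Z k v -> B k v) /\
  (forall k v, (e <= k)%N -> Z k.+1 v -> exists w : 'I_n -> M,
     (forall i, Z k (w i)) /\ B k.+1 (v - \sum_i X i (w i))).

(* Elements of R_j (x) M_e, with R_j spanned by the monomials of degree j; degrees
   of syzygies are counted relative to e. *)
Definition syzZ e j (f : mfun n M) :=
  [/\ msupported j f, mvalued (Z e) f & B (e + j) (gev j f)].
Definition syzB e j (f : mfun n M) := msupported j f /\ mvalued (B e) f.

Lemma syz_axioms e : gmod_axioms (@mfunX n M) (syzZ e) (syzB e).
Proof.
split.
- by move=> i f g; exact: mfunX_sub.
- by move=> i j f; exact: mfunX_comm.
- by move=> j; split=> // u; exact: gB0.
- move=> j f g [f1 f2] [g1 g2]; split=> u; rewrite mfunB; last exact: gB_sub.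
  by move=> du; rewrite f1 // g1 // subr0.
- by move=> j i f [f1 f2]; split; [exact: msupportedX|apply: mvaluedX => //; exact: gB0].
- move=> j f g [f1 f2 f3] [g1 g2 g3]; split.
  + by move=> u du; rewrite mfunB f1 // g1 // subr0.
  + by move=> u; exact: gZ_sub.
  + by rewrite gev_sub; exact: gB_sub.
- move=> j i f [f1 f2 f3]; split; first exact: msupportedX.
    by apply: mvaluedX => //; exact: gZ0.
  by rewrite gevX addnS; exact: gB_X.
- by move=> j f [f1 f2]; split=> // [u|]; [exact: gBZ|exact: gev_B].
Qed.

Definition syz e : gmodule n := Gmodule (syz_axioms e).

(** Surjectivity of [gev]: generation in degree [e] peels off one variable at a time. *)
Lemma gen_in_gev e : gen_in e -> forall j v, Z (e + j) v ->
  exists f : mfun n M, [/\ msupported j f, mvalued (Z e) f & B (e + j) (v - gev j f)].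
Proof.
move=> [_ G]; elim=> [|j IH] v Zv.
  exists (fun u => if u == 0%MM then v else 0); split.
  + by move=> u; case: eqP => // -> /=; rewrite mdeg0.
  + by move=> u; case: eqP => // _; [rewrite addn0 in Zv|exact: gZ0].
  + by rewrite gev0 eqxx subrr; exact: gB0.
rewrite addnS in Zv; have [w [Zw Bw]] := G (e + j)%N v (leq_addr _ _) Zv.
have [f Hf] := fun_choice (fun i => IH _ (Zw i)).
exists (\sum_i mfunX i (f i)).
have [f1 f2 f3] : [/\ forall i, msupported j (f i), forall i, mvalued (Z e) (f i) &
    forall i, B (e + j) (w i - gev j (f i))] by split=> i; case: (Hf i).
pose ap u (g : mfun n M) := g u.
have apE u (F : 'I_n -> mfun n M) : (\sum_i F i) u = \sum_i (F i u).
  by rewrite -/(ap u _) (sub_morph_sum (h := ap u)).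
split.
+ by move=> u du; rewrite apE big1 // => i _; apply: msupportedX.
+ by move=> u; rewrite apE; apply: gZ_sum => i _; apply: mvaluedX => //; exact: gZ0.
+ rewrite (sub_morph_sum (gev_sub j.+1)) addnS.
  rewrite -(subrK (\sum_i X i (w i)) v) -addrA; apply: gBD => //.
  rewrite -sumrB; apply: gB_sum => i _; rewrite gevX -gX_sub; exact: gB_X.
Qed.

End GmodTheory.

(** An e-linear module satisfies this for every [t]. Degrees of syzygies are counted from [e], so
    each later stage is generated in degree 1. The depth is explicit because every syzygy module has
    a new carrier, over which the recursion must range. *)
Fixpoint lin (t n : nat) (M : gmodule n) (e : nat) : Prop :=
  if t is t'.+1 then gen_in M e /\ lin t' (syz M e) 1 else True.

Lemma linW t n (M : gmodule n) e : lin t.+1 M e -> lin t M e.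
Proof. by elim: t n M e => // t IH n M e /= [g h]; split=> //; exact: IH. Qed.

(** * Isomorphisms of subquotients *)

Section Iso.
Variables (n : nat) (M N : gmodule n) (h : M -> N).

(** An isomorphism of the quotients Z/B induced by a map of the carriers. No inverse map is asked
    for: surjectivity holds only modulo B. *)
Record gm_iso : Prop := GmIso {
  iso_sub : forall u v, h (u - v) = h u - h v;
  iso_X : forall i v, h (gm_X M i v) = gm_X N i (h v);
  iso_Z : forall k v, gm_Z M k v -> gm_Z N k (h v);
  iso_B : forall k v, gm_B M k v -> gm_B N k (h v);
  iso_inj : forall k v, gm_Z M k v -> gm_B N k (h v) -> gm_B M k v;
  iso_surj : forall k w, gm_Z N k w -> exists2 v, gm_Z M k v & gm_B N k (w - h v) }.

Hypothesis H : gm_iso.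

Lemma iso_gev j f : h (gev j f) = gev j (fun u => h (f u)).
Proof.
rewrite /gev (sub_morph_sum (iso_sub H)); apply: eq_bigr => u _.
move: (f u) => v; elim/mnm_add1_ind: u => [|u i IH]; first by rewrite !mact0.
by rewrite !mact_add1 (iso_X H) IH.
Qed.

Lemma iso_gen_in e : gen_in M e <-> gen_in N e.
Proof.
split=> -[G1 G2]; split.
- move=> k w lke Zw; have [v Zv Bv] := iso_surj H Zw.
  by apply/(gB_congr Bv); apply: (iso_B H); exact: G1.
- move=> k w lek Zw; have [v Zv Bv] := iso_surj H Zw.
  have [r [Zr Br]] := G2 k v lek Zv; exists (fun i => h (r i)); split.
    by move=> i; exact: (iso_Z H).
  rewrite -(subrK (h v) w) -addrA; apply: gBD => //.
  rewrite (eq_bigr (fun i => h (gm_X M i (r i)))); last by move=> i _; rewrite (iso_X H).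
  by rewrite -(sub_morph_sum (iso_sub H)) -(iso_sub H); exact: (iso_B H).
- move=> k v lke Zv; apply: (iso_inj H) => //; apply: G1 => //; exact: (iso_Z H).
- move=> k v lek Zv; have [r [Zr Br]] := G2 k _ lek (iso_Z H Zv).
  have [s Hs] := fun_choice (fun i => ex2_ind (fun a b c => ex_intro _ a (conj b c))
    (iso_surj H (Zr i))).
  exists s; split=> [i|]; first by case: (Hs i).
  apply: (iso_inj H).
    by apply: gZ_sub => //; apply: gZ_sum => i _; apply: gZ_X; case: (Hs i).
  rewrite (iso_sub H) (sub_morph_sum (iso_sub H)).
  rewrite -(subrK (\sum_i gm_X N i (r i)) (h v)) -addrA; apply: gBD => //.
  rewrite -sumrB; apply: gB_sum => i _; rewrite (iso_X H) -gX_sub; apply: gB_X.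
  by case: (Hs i).
Qed.

End Iso.

Lemma iso_syz n (M N : gmodule n) (h : M -> N) e : gm_iso h ->
  @gm_iso n (syz M e) (syz N e) (fun f u => h (f u)).
Proof.
move=> H; have h0 := sub_morph0 (iso_sub H); split.
- by move=> f g; apply: functional_extensionality => u; exact: (iso_sub H).
- by move=> i f; apply: functional_extensionality => u /=; rewrite /mfunX; case: ifP.
- move=> j f [f1 f2 f3]; split=> [u du|u|]; first by rewrite f1.
    exact: (iso_Z H).
  by rewrite -(iso_gev H); exact: (iso_B H).
- by move=> j f [f1 f2]; split=> [u du|u]; [rewrite f1|exact: (iso_B H)].
- by move=> j f [f1 f2 f3] [g1 g2]; split=> // u; apply: (iso_inj H).
- move=> j g [g1 g2 g3].
  have /fun_choice[f Hf] : forall u, exists v, [/\ (mdeg u <> j -> v = 0), gm_Z M e v &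
      gm_B N e (g u - h v)].
    move=> u; have [du|/eqP du] := eqVneq (mdeg u) j.
      by have [v Zv Bv] := iso_surj H (g2 u); exists v.
    by exists 0; split=> //; [exact: gZ0|rewrite g1 // h0 subr0; exact: gB0].
  have f1 : msupported j f by move=> u; case: (Hf u).
  have f2 : mvalued (gm_Z M e) f by move=> u; case: (Hf u).
  have Bgf : syzB e j ((g : mfun n N) - ((fun u => h (f u)) : mfun n N)).
    split=> u; last by case: (Hf u).
    by move=> du; rewrite mfunB g1 // f1 // h0 subr0.
  exists f => //; split=> //; apply: (iso_inj H); first exact: gev_Z.
  rewrite (iso_gev H); have [_ /(@gev_B _ _ _ j)] := Bgf; rewrite gev_sub.
  by move=> h1; case: (gB_congr h1) => + _; apply.
Qed.

Lemma lin_iso t n (M N : gmodule n) (h : M -> N) e : gm_iso h -> lin t M e <-> lin t N e.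
Proof.
elim: t n M N h e => //= t IH n M N h e H.
by rewrite (iso_gen_in H) (IH _ _ _ _ _ (iso_syz e H)).
Qed.

Lemma lin_zero t n (M : gmodule n) e : (forall k v, gm_Z M k v -> gm_B M k v) -> lin t M e.
Proof.
elim: t n M e => //= t IH n M e H; split.
  split=> k v _; first exact: H.
  move=> Zv; exists (fun _ => 0); split=> [i|]; first exact: gZ0.
  by rewrite big1 ?subr0 => [|i _]; [exact: H|exact: gX0].
by apply: IH => k f [f1 f2 f3]; split=> // u; exact: H.
Qed.

(** * Short exact sequences *)

(** With B inside Z' inside Z, the submodule is Z'/B and the quotient is Z/Z', both on the same
    carrier, so a short exact sequence involves no maps. *)
Record gm_submodule (n : nat) (M : gmodule n) (Z' : nat -> M -> Prop) : Prop := GmSubmodule {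
  gsub_sub : forall k u v, Z' k u -> Z' k v -> Z' k (u - v);
  gsub_X : forall k i v, Z' k v -> Z' k.+1 (gm_X M i v);
  gsub_B : forall k v, gm_B M k v -> Z' k v;
  gsub_Z : forall k v, Z' k v -> gm_Z M k v }.

Section SubQuo.
Variables (n : nat) (M : gmodule n) (Z' : nat -> M -> Prop) (H : gm_submodule Z').

Lemma gm_sub_axioms : gmod_axioms (gm_X M) Z' (gm_B M).
Proof. by case: H; case: (gm_ax M); split. Qed.

Lemma gm_quo_axioms : gmod_axioms (gm_X M) (gm_Z M) Z'.
Proof.
case: H => H1 H2 H3 H4; case: (gm_ax M) => A1 A2 A3 A4 A5 A6 A7 A8; split=> //.
by move=> k; exact: H3.
Qed.

Definition gm_sub : gmodule n := Gmodule gm_sub_axioms.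
Definition gm_quo : gmodule n := Gmodule gm_quo_axioms.
End SubQuo.

Section Horseshoe.
Variables (n : nat) (M : gmodule n) (Z' : nat -> M -> Prop) (H : gm_submodule Z').
Variable e : nat.

Lemma ses_gen_in : gen_in (gm_sub H) e -> gen_in M e <-> gen_in (gm_quo H) e.
Proof.
move=> [S1 S2]; split=> -[G1 G2]; split.
- by move=> k v lke /(G1 _ _ lke); exact: (gsub_B H).
- move=> k v lek /(G2 _ _ lek)[w [Zw Bw]]; exists w; split=> //; exact: (gsub_B H).
- by move=> k v lke /(G1 _ _ lke); exact: S1.
- move=> k v lek /(G2 _ _ lek)[w [Zw Bw]]; have [w' [Zw' Bw']] := S2 _ _ lek Bw.
  exists (fun i => w i + w' i); split=> [i|]; first by apply: gZD; [exact: Zw|exact: (gsub_Z H (Zw' i))].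
  under eq_bigr do rewrite (sub_morphD (gX_sub _)).
  by rewrite big_split opprD addrA.
Qed.

Definition syz_sub j (f : syz M e) := gm_Z (syz M e) j f /\ mvalued (Z' e) f.

Lemma syz_sub_submodule : @gm_submodule n (syz M e) syz_sub.
Proof.
split.
- move=> k f g [f1 f2] [g1 g2]; split; first exact: (@gZ_sub _ (syz M e)).
  by move=> u; exact: (gsub_sub H).
- move=> k i f [f1 f2]; split; first exact: (@gZ_X _ (syz M e)).
  by apply: mvaluedX => //; apply: (gsub_B H); exact: gB0.
- move=> k f Bf; split; first exact: (@gBZ _ (syz M e)).
  by move=> u; apply: (gsub_B H); case: Bf.
- by move=> k f [].
Qed.

Lemma syz_sub_iso : gm_iso (M := gm_sub syz_sub_submodule) (N := syz (gm_sub H) e) id.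
Proof.
split=> //.
- by move=> k f [[f1 f2 f3] f4].
- move=> k f [f1 f2 f3]; exists f; last by rewrite subrr; exact: (@gB0 _ (syz (gm_sub H) e)).
  by split=> //; split=> // u; exact: (gsub_Z H (f2 u)).
Qed.

(** Syzygies of the quotient lift to syzygies of [M]: a syzygy [g] of the quotient evaluates into
    Z', and generation of the kernel in degree [e] supplies a correction with values in Z' and the
    same evaluation. *)
Lemma syz_quo_iso : gen_in (gm_sub H) e ->
  gm_iso (M := gm_quo syz_sub_submodule) (N := syz (gm_quo H) e) id.
Proof.
move=> G; split=> //.
- by move=> k f [f1 f2 f3]; split=> //; exact: (gsub_B H).
- by move=> k f [[f1 f2 f3] f4].
- by move=> k f Zf [f1 f2].
- move=> k g [g1 g2 g3].
  have [f [f1 f2 f3]] := gen_in_gev G g3.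
  exists ((g : mfun n M) - f); last by rewrite subKr.
  split; first by move=> u du; rewrite mfunB g1 // f1 // subr0.
    by move=> u; apply: gZ_sub; [exact: g2|exact: (gsub_Z H (f2 u))].
  by rewrite gev_sub.
Qed.

End Horseshoe.

(** Horseshoe lemma: the syzygies of the three terms form a short exact sequence again, with a
    kernel that is linear in degree 1 to the remaining depth, so the induction on [t] repeats. *)
Lemma lin_ses t n (M : gmodule n) (Z' : nat -> M -> Prop) (H : gm_submodule Z') e :
  lin t (gm_sub H) e -> lin t M e <-> lin t (gm_quo H) e.
Proof.
elim: t n M Z' H e => //= t IH n M Z' H e [G L].
have L' : lin t (gm_sub (syz_sub_submodule H e)) 1 by apply/(lin_iso t 1 (syz_sub_iso H e)).
by rewrite (ses_gen_in G) (IH _ _ _ _ _ L') (lin_iso t 1 (syz_quo_iso G)).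
Qed.

(** * Reduction modulo a regular variable *)

Section Inc.
Variable n : nat.

Definition minc (u : 'X_{1..n}) : 'X_{1..n.+1} :=
  [multinom (if unlift ord0 i is Some j then u j else 0%N) | i < n.+1].
Definition mres (w : 'X_{1..n.+1}) : 'X_{1..n} := [multinom w (lift ord0 j) | j < n].

Lemma minc_ord0 u : minc u ord0 = 0%N.
Proof. by rewrite mnmE unlift_none. Qed.
Lemma minc_lift u j : minc u (lift ord0 j) = u j.
Proof. by rewrite mnmE liftK. Qed.
Lemma mincK : cancel minc mres.
Proof. by move=> u; apply/mnmP => j; rewrite mnmE minc_lift. Qed.
Lemma mresK (w : 'X_{1..n.+1}) : w ord0 = 0%N -> minc (mres w) = w.
Proof.
move=> w0; apply/mnmP => i; rewrite mnmE; case: unliftP => [j ->|->] //.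
by rewrite mnmE.
Qed.
Lemma minc0 : minc 0 = 0%MM.
Proof. by apply/mnmP => i; rewrite mnmE mnm0E; case: unliftP => // j _; rewrite mnm0E. Qed.
Lemma minc_add1 u j : minc (u + U_(j)) = (minc u + U_(lift ord0 j))%MM.
Proof.
apply/mnmP => i; rewrite mnmDE !mnmE; case: unliftP => [l ->|->].
  by rewrite mnmDE mnm1E (inj_eq lift_inj).
by rewrite eq_sym (negbTE (neq_lift _ _)).
Qed.
Lemma mdeg_minc u : mdeg (minc u) = mdeg u.
Proof.
elim/mnm_add1_ind: u => [|u i IH]; rewrite ?minc0 ?mdeg0 //.
by rewrite minc_add1 !mdegD !mdeg1 IH.
Qed.

Variable V : zmodType.

Definition mext (g : mfun n V) : mfun n.+1 V :=
  fun w => if w ord0 == 0%N then g (mres w) else 0.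
Definition mshift (f : mfun n.+1 V) : mfun n.+1 V := fun w => f (w + U_(ord0))%MM.

Lemma mext_minc g u : mext g (minc u) = g u.
Proof. by rewrite /mext minc_ord0 mincK. Qed.

Lemma mfunX_minc (f : mfun n.+1 V) u : mfunX ord0 f (minc u) = 0.
Proof. by rewrite /mfunX minc_ord0. Qed.

(** Division by x_0: the remainder is the part free of x_0 and the quotient is [mshift f]. *)
Lemma mfun_decomp (f : mfun n.+1 V) : f = mext (fun u => f (minc u)) + mfunX ord0 (mshift f).
Proof.
apply: functional_extensionality => w; rewrite mfunD /mext /mfunX lt0n.
have [w0|w0] := eqVneq (w ord0) 0%N; first by rewrite mresK // addr0.
by rewrite add0r /mshift submK // lep1mP.
Qed.

End Inc.

Section Red.
Variables (n : nat) (M : gmodule n.+1).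

Lemma gm_restr_axioms : gmod_axioms (fun i => gm_X M (lift ord0 i)) (gm_Z M) (gm_B M).
Proof. by case: (gm_ax M) => A1 A2 A3 A4 A5 A6 A7 A8; split=> *; auto. Qed.
Definition gm_restr : gmodule n := Gmodule gm_restr_axioms.

Lemma mact_minc u v : mact (M := M) (minc u) v = mact (M := gm_restr) u v.
Proof.
by elim/mnm_add1_ind: u => [|u i IH]; rewrite ?minc0 ?mact0 // minc_add1 !mact_add1 IH.
Qed.

Lemma gev_mext j g : gev (M := M) j (mext g) = gev (M := gm_restr) j g.
Proof.
rewrite /gev (bigID (fun w : 'X_{1..n.+1} => w ord0 == 0%N)) /=.
rewrite [X in _ + X]big1_seq ?addr0; last first.
  by move=> w /andP[/negbTE h _]; rewrite /mext h (sub_morph0 (mact_sub (M := M) w)).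
rewrite -big_filter (perm_big (map (@minc n) (mons n j))) /=.
  by rewrite big_map; apply: eq_bigr => u _; rewrite mext_minc mact_minc.
apply: uniq_perm => [||w].
- by rewrite filter_uniq ?uniq_mons.
- by rewrite map_inj_uniq ?uniq_mons //; exact: (can_inj (@mincK n)).
rewrite mem_filter mem_mons; apply/andP/mapP => [[/eqP w0 dw]|[u]].
  by exists (mres w); rewrite ?mresK // mem_mons -mdeg_minc mresK.
by rewrite mem_mons => du ->; rewrite minc_ord0 mdeg_minc.
Qed.

(** B + x_0 Z, which presents M / x_0 M; in degree 0 there are no multiples of x_0. *)
Definition redB k (v : M) :=
  if k is k'.+1 then exists2 z, gm_Z M k' z & gm_B M k (v - gm_X M ord0 z) else gm_B M 0 v.

Lemma redBW k v : gm_B M k v -> redB k v.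
Proof. by case: k => //= k Bv; exists 0; [exact: gZ0|rewrite gX0 subr0]. Qed.

Lemma gm_red_axioms : gmod_axioms (fun i => gm_X M (lift ord0 i)) (gm_Z M) redB.
Proof.
split.
- by move=> i; exact: gX_sub.
- by move=> i j; exact: gX_comm.
- by move=> k; apply: redBW; exact: gB0.
- case=> [|k] u v; first exact: gB_sub.
  move=> [z Zz Bz] [y Zy By]; exists (z - y); first exact: gZ_sub.
  by rewrite gX_sub opprD addrACA -opprD; exact: gB_sub.
- case=> [|k] i v /=; first by move/(gB_X (lift ord0 i)); exact: redBW.
  move=> [z Zz Bz]; exists (gm_X M (lift ord0 i) z); first exact: gZ_X.
  by rewrite gX_comm -gX_sub; exact: gB_X.
- by move=> k u v; exact: gZ_sub.
- by move=> k i v; exact: gZ_X.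
- case=> [|k] v /=; first exact: gBZ.
  move=> [z Zz Bz]; rewrite -(subrK (gm_X M ord0 z) v).
  by apply: gZD; [exact: gBZ|exact: gZ_X].
Qed.
Definition gm_red : gmodule n := Gmodule gm_red_axioms.

Definition X0_regular := forall k v, gm_Z M k v -> gm_B M k.+1 (gm_X M ord0 v) -> gm_B M k v.

(** Graded Nakayama lemma. Below [e] the multiples of x_0 disappear by induction on the degree; from
    [e] on they provide the coefficient of x_0. *)
Lemma red_gen_in e : gen_in M e <-> gen_in gm_red e.
Proof.
split=> -[G1 G2]; split.
- by move=> k v lke /(G1 _ _ lke); exact: redBW.
- move=> k v lek /(G2 _ _ lek)[w [Zw]]; rewrite big_ord_recl => Bw.
  exists (fun i => w (lift ord0 i)); split=> //=; exists (w ord0) => //.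
  by rewrite -addrA -opprD [X in _ - X]addrC.
- elim=> [|k IH] v lke /(G1 _ _ lke) //= [z Zz Bz].
  rewrite -(subrK (gm_X M ord0 z) v); apply: gBD => //; apply: gB_X.
  by apply: IH => //; exact: ltnW.
- move=> k v lek /(G2 _ _ lek)[w [Zw [z Zz Bz]]].
  exists (fun i => if unlift ord0 i is Some j then w j else z); split.
    by move=> i; case: unliftP => [j _|_]; [exact: Zw|exact: Zz].
  rewrite big_ord_recl unlift_none; under eq_bigr do rewrite liftK.
  by rewrite opprD addrA addrAC; exact: Bz.
Qed.

(** M and M / x_0 M agree in degree [e], since x_0 M starts in degree [e + 1]. *)
Lemma redB_low e v : gen_in M e -> redB e v -> gm_B M e v.
Proof.
case: e => // e [G1 _] /= [z Zz Bz]; rewrite -(subrK (gm_X M ord0 z) v).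
by apply: gBD => //; apply: gB_X; exact: G1.
Qed.

End Red.

(** Syzygies lie in R tensor M_e, on which x_0 acts injectively. *)
Lemma syz_regular n (M : gmodule n.+1) e : X0_regular (syz M e).
Proof. by move=> j f [f1 f2 f3] [g1 g2]; split=> // u; rewrite -(mfunX_add1 ord0 f u); exact: g2. Qed.

Lemma mshift_supported n (M : gmodule n) i j (f : mfun n M) : msupported j.+1 f ->
  msupported j (fun w => f (w + U_(i))%MM).
Proof. by move=> fs w dw; apply: fs; rewrite mdegD mdeg1 addn1 => -[]. Qed.

Lemma mext_supported n (M : gmodule n.+1) j (g : mfun n (gm_restr M)) :
  msupported j g -> @msupported n.+1 M j (mext g).
Proof.
by move=> gs w dw; rewrite /mext; case: eqP => // w0; apply: gs; rewrite -mdeg_minc mresK.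
Qed.

(** Regularity amounts to Tor_1(M, R/x_0) = 0, so taking syzygies commutes with reduction modulo
    x_0. The isomorphism keeps the part of a syzygy that is free of x_0. *)
Lemma red_syz_iso n (M : gmodule n.+1) e : X0_regular M -> gen_in M e ->
  gm_iso (M := gm_red (syz M e)) (N := syz (gm_red M) e) (fun f u => f (minc u)).
Proof.
move=> reg G; pose res (f : mfun n.+1 M) : mfun n M := fun u => f (minc u).
have evE j f : gev (M := M) j.+1 f =
    gev (M := gm_red M) j.+1 (res f) + gm_X M ord0 (gev j (mshift f)).
  rewrite {1}(mfun_decomp f) (sub_morphD (gev_sub (M := M) j.+1)) gevX.
  by rewrite gev_mext.
have supp j f : msupported (M := M) j f -> msupported (M := gm_red M) j (res f).
  by move=> h u du; apply: h; rewrite mdeg_minc.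
split.
- by [].
- move=> i f; apply: functional_extensionality => u /=.
  rewrite /mfunX minc_lift; case: ifP => // ui; congr (f _); apply/mnmP => l.
  by rewrite mnmBE !mnmE; case: unliftP => [m ->|->]; rewrite // mnmBE mnm1E (inj_eq lift_inj).
- move=> j f [f1 f2 f3]; split; [exact: supp|by move=> u; exact: f2|].
  case: j f1 f3 => [|j] f1 f3.
    rewrite gev0 /= minc0; apply: redBW; move: f3; rewrite gev0 addn0; exact: id.
  rewrite addnS /=; exists (- gev j (mshift f)).
    by apply: gZN; apply: gev_Z => u; exact: f2.
  by rewrite (sub_morphN (gX_sub ord0)) opprK -addnS -evE.
- case=> [|j] f /= => [[f1 f2]|[z [z1 z2 z3] [f1 f2]]].
    by split; [exact: supp|move=> u; apply: redBW; exact: f2].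
  have E u : f (minc u) = (f - mfunX ord0 z : mfun n.+1 M) (minc u).
    by rewrite mfunB mfunX_minc subr0.
  split=> u; last by rewrite /= E; apply: redBW; exact: f2.
  by move=> du; rewrite E; apply: f1; rewrite mdeg_minc.
- move=> j f [f1 f2 f3] [g1 g2].
  have Bm u : gm_B M e (f (minc u)) by apply: redB_low G _; exact: g2.
  case: j f1 f3 g1 => [|j] f1 f3 g1 /=.
    split=> // u; have [->|ne] := eqVneq u 0%MM; first by rewrite -minc0.
    by rewrite f1; [exact: gB0|apply/eqP; rewrite mdeg_eq0].
  have E : f - mfunX ord0 (mshift f) = mext (res f) by rewrite {1}(mfun_decomp f) addrK.
  have Bx : gm_B M (e + j.+1) (gev j.+1 (mext (res f))).
    by apply: gev_B => w; rewrite /mext; case: ifP => _; [exact: Bm|exact: gB0].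
  exists (mshift f); last first.
    rewrite E; split; first exact: mext_supported.
    by move=> w; rewrite /mext; case: ifP => _; [exact: Bm|exact: gB0].
  split; [exact: mshift_supported|by move=> u; exact: f2|].
  (* Modulo B, [f] is x_0 times [mshift f]; regularity makes [mshift f] itself a syzygy. *)
  apply: reg; first by apply: gev_Z => u; exact: f2.
  rewrite -addnS -gevX.
  have -> : mfunX ord0 (mshift f) = f - mext (res f) by rewrite -E subKr.
  by rewrite gev_sub; exact: gB_sub.
- move=> j g [g1 g2 g3].
  have res_ext : res (mext g) = g by apply: functional_extensionality => u; exact: mext_minc.
  have ext_Z : mvalued (gm_Z M e) (mext g).
    by move=> w; rewrite /mext; case: ifP => _; [exact: g2|exact: gZ0].
  have ext_s : msupported (M := M) j (mext g) by exact: mext_supported.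
  have ext_ev : gev j (mext g) = gev (M := gm_red M) j g by exact: gev_mext.
  case: j g1 g3 ext_s ext_ev => [|j] g1 g3 ext_s ext_ev.
    exists (mext g).
      split=> //; rewrite ext_ev; move: g3; rewrite addn0; exact: redB_low.
    by rewrite -/(res (mext g)) res_ext subrr; exact: (@gB0 _ (syz (gm_red M) e)).
  (* Modulo B, [g] evaluates to x_0 [z], and [z] is the value of some [f] by generation; subtracting
     x_0 [f] turns the extension of [g] into a syzygy. *)
  move: g3; rewrite addnS /= => -[z Zz Bz].
  have [f [f1 f2 f3]] := gen_in_gev G Zz.
  exists (mext g - mfunX ord0 f : mfun n.+1 M); last first.
    rewrite (_ : (fun u => _) = g); last first.
      by apply: functional_extensionality => u; rewrite mfunB mfunX_minc subr0 mext_minc.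
    by rewrite subrr; exact: (@gB0 _ (syz (gm_red M) e)).
  split.
  + by move=> w dw; rewrite mfunB ext_s // (msupportedX ord0 f1) // subr0.
  + by move=> w; apply: gZ_sub => //; apply: mvaluedX => //; exact: gZ0.
  + rewrite gev_sub gevX ext_ev addnS.
    rewrite -(subrK (gm_X M ord0 z) (gev _ g)) -addrA -gX_sub.
    by apply: gBD => //; exact: gB_X.
Qed.

Lemma lin_red t n (M : gmodule n.+1) e : X0_regular M -> lin t M e <-> lin t (gm_red M) e.
Proof.
elim: t n M e => //= t IH n M e reg; rewrite -red_gen_in.
split=> -[G L]; split=> //.
  by apply/(lin_iso t 1 (red_syz_iso reg G))/IH => //; exact: syz_regular.
by apply/IH; [exact: syz_regular|apply/(lin_iso t 1 (red_syz_iso reg G))].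
Qed.

(** * Modules concentrated in one degree, and socles *)

Section ConcStep.
Variables (n : nat) (M : gmodule n.+1) (e : nat).
Hypothesis conc : forall k v, k <> e -> gm_Z M k v -> gm_B M k v.

Let S : gmodule n := gm_red (syz M e).
(** Classes of the syzygies that are, modulo B, of the form x_0 h, where h in R tensor M_e need not
    be a syzygy. *)
Definition x0_multiples j (f : S) := gm_Z S j f /\ forall u, gm_B M e (f (minc u)).

Lemma x0_multiples_submodule : @gm_submodule n S x0_multiples.
Proof.
split.
- move=> j f g [f1 f2] [g1 g2]; split; first exact: (@gZ_sub _ S).
  by move=> u; exact: gB_sub.
- move=> j i f [f1 f2]; split; first exact: (@gZ_X _ S).
  move=> u; rewrite /= /mfunX minc_lift; case: ifP => ui; last exact: gB0.
  suff -> : (minc u - U_(lift ord0 i))%MM = minc (u - U_(i)) by exact: f2.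
  by rewrite -[in LHS](@submK _ U_(i) u) ?minc_add1 ?addmK // lep1mP -lt0n.
- move=> j f Bf; split; first exact: (@gBZ _ S).
  case: j Bf => [[_ h] u|j [z _ [_ h]] u]; first exact: h.
  have : gm_B M e ((f - mfunX ord0 z : mfun n.+1 M) (minc u)) by exact: h.
  by rewrite mfunB mfunX_minc subr0.
- by move=> j f [].
Qed.

(** If h has positive degree, it is a syzygy because M vanishes outside degree [e], and then x_0 h
    is zero in the reduction. Only x_0 tensor M_e survives, in degree 1. *)
Lemma x0_multiples_conc j f : j <> 1%N -> gm_Z (gm_sub x0_multiples_submodule) j f ->
  gm_B (gm_sub x0_multiples_submodule) j f.
Proof.
move=> j1 [[f1 f2 f3] fB].
have Bx : mvalued (gm_B M e) (mext (fun u => f (minc u))).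
  by move=> w; rewrite /mext; case: ifP => _; [exact: fB|exact: gB0].
case: j j1 f1 f3 => [|[//|j]] _ f1 f3.
  split=> // u; have [->|ne] := eqVneq u 0%MM; first by rewrite -minc0; exact: fB.
  by rewrite f1; [exact: gB0|apply/eqP; rewrite mdeg_eq0].
exists (mshift f).
  split; [exact: mshift_supported|by move=> u; exact: f2|].
  by apply: conc; [lia|apply: gev_Z => u; exact: f2].
have E : (f : mfun n.+1 M) - mfunX ord0 (mshift f) = mext (fun u => f (minc u)).
  by rewrite {1}(mfun_decomp f) addrK.
rewrite [_ - _]E; split=> //; apply: mext_supported => u du.
by apply: f1; rewrite mdeg_minc.
Qed.

(** What remains are the parts free of x_0, which are the syzygies of M over the other variables. *)
Lemma x0_quotient_iso :
  gm_iso (M := gm_quo x0_multiples_submodule) (N := syz (gm_restr M) e) (fun f u => f (minc u)).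
Proof.
split.
- by [].
- move=> i f; apply: functional_extensionality => u /=.
  rewrite /mfunX minc_lift; case: ifP => // ui; congr (f _).
  by rewrite -[in LHS](@submK _ U_(i) u) ?minc_add1 ?addmK // lep1mP -lt0n.
- move=> j f [f1 f2 f3]; split=> [u du|u|]; [by apply: f1; rewrite mdeg_minc|exact: f2|].
  case: j f1 f3 => [|j] f1 f3.
    by move: f3; rewrite !gev0 minc0.
  by apply: conc; [lia|apply: (@gev_Z _ (gm_restr M)) => u; exact: f2].
- by move=> j f [[f1 f2 f3] fB]; split=> // u du; apply: f1; rewrite mdeg_minc.
- by move=> j f Zf [_ fB]; split.
- move=> j g [g1 g2 g3]; exists (mext g).
    split; first exact: mext_supported.
      by move=> w; rewrite /mext; case: ifP => _; [exact: g2|exact: gZ0].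
    by rewrite gev_mext.
  rewrite (_ : (fun u => _) = g); first by rewrite subrr; exact: (@gB0 _ (syz (gm_restr M) e)).
  by apply: functional_extensionality => u; exact: mext_minc.
Qed.

End ConcStep.

(** The syzygies, reduced modulo x_0, are an extension of the syzygies over one variable less by a
    module concentrated in degree 1; induction on the number of variables applies to both. *)
Lemma lin_conc t n (M : gmodule n) e :
  (forall k v, k <> e -> gm_Z M k v -> gm_B M k v) -> lin t M e.
Proof.
elim: n t M e => [|n IH] [//|t] M e conc; split.
1,3: split=> k v lk Zv; first by apply: conc Zv; lia.
1,2: exists (fun _ => 0); split=> [i|]; first exact: gZ0.
1,2: by rewrite big1 ?subr0 => [|i _]; [apply: conc Zv; lia|exact: gX0].
(* Without variables the only monomial is 1, on which evaluation is injective. *)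
- apply: lin_zero => k f [f1 f2 f3]; split=> // u.
  have [du|/eqP du] := eqVneq (mdeg u) k; last by rewrite f1 //; exact: gB0.
  move: du f3; rewrite (nvar0_mnmE u) mdeg0 => <-; rewrite gev0 addn0.
  exact: id.
- apply/(lin_red _ _ (@syz_regular _ M e)).
  have L : lin t (gm_sub (x0_multiples_submodule M e)) 1.
    by apply: IH => k v; exact: x0_multiples_conc.
  apply/(lin_ses L)/(lin_iso _ _ (x0_quotient_iso conc)).
  by have [] := IH t.+1 (gm_restr M) e conc.
Qed.

(** Write [v] as the value of some f. If [v] is in the socle, all x_i f are syzygies, so x_0 f is a
    socle element of the syzygies modulo x_0, a 1-linear module in one variable less. Hence x_0 f is
    x_0 times a syzygy, f is a syzygy, and [v] vanishes. *)
Lemma lin_socle n (M : gmodule n) e : (forall t, lin t M e) ->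
  forall k v, (e < k)%N -> gm_Z M k v -> (forall i, gm_B M k.+1 (gm_X M i v)) -> gm_B M k v.
Proof.
elim: n M e => [|n IH] M e L k v lek Zv Xv.
  have [[_ G] _] := L 1%N; case: k lek Zv Xv => // k lek Zv _.
  by have [w [_]] := G k v lek Zv; rewrite big_ord0 subr0.
have [G _] := L 1%N; have [j def_k] : exists j, k = (e + j.+1)%N by exists (k - e).-1; lia.
subst k; have [f [f1 f2 f3]] := gen_in_gev G Zv.
have XfZ i : gm_Z (syz M e) j.+2 (mfunX i f).
  split; first exact: msupportedX.
    by apply: mvaluedX => //; exact: gZ0.
  rewrite gevX addnS; apply/(gB_congr (v := gm_X M i v)) => //.
  by rewrite -gX_sub -opprB; apply: gB_X; exact: gBN.
have [] := IH (gm_red (syz M e)) 1%N _ j.+2 (mfunX ord0 f) => //.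
- by move=> t; apply/(lin_red _ _ (@syz_regular _ M e)); case: (L t.+1).
- exact: (XfZ ord0).
- move=> i; exists (mfunX (lift ord0 i) f); first exact: XfZ.
  rewrite [gm_X _ _ _]mfunX_comm subrr; exact: (@gB0 _ (syz M e)).
move=> h [h1 h2 h3] [B1 B2]; apply/(gB_congr f3).
rewrite -(subrK h f) (sub_morphD (gev_sub (M := M) _)); apply: gBD => //.
apply: gev_B => u; have := B2 (u + U_(ord0))%MM.
by rewrite -[_ - _](@mfunX_sub _ M) mfunX_add1.
Qed.

(* The degree e + 1 generators of the syzygies of the quotient are the only
   possible source of generators of the submodule beyond degree e. *)
Lemma submodule_vanishes_above n (M : gmodule n) (Z' : nat -> M -> Prop)
    (H : gm_submodule Z') e : gen_in M e -> lin 2 (gm_quo H) e ->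
  (forall v, Z' e.+1 v -> gm_B M e.+1 v) ->
  forall k v, (e < k)%N -> Z' k v -> gm_B M k v.
Proof.
move=> G [_ [[_ G2] _]] B1 k v lek.
have [j def_k] : exists j, k = (e + j.+1)%N by exists (k - e).-1; lia.
subst k; elim: j v {lek} => [|j IH] v Z'v; first by move: Z'v; rewrite addn1; exact: B1.
have [f [f1 f2 f3]] := gen_in_gev G (gsub_Z H Z'v).
(* [v] vanishes in the quotient, so [f] is one of its syzygies. *)
have Zf : gm_Z (syz (gm_quo H) e) j.+2 f.
  have: Z' (e + j.+2)%N (gev j.+2 f).
    by rewrite -(subKr v (gev _ f)); apply: (gsub_sub H) => //; exact: (gsub_B H).
  by split.
have [w [Zw [_ Bw]]] := G2 j.+1 f isT Zf.
apply/(gB_congr f3).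
rewrite -(subrK (\sum_i mfunX i (w i)) f) (sub_morphD (gev_sub (M := M) _)); apply: gBD.
  (* The remainder has values in Z' of degree [e], and a monomial of positive degree sends these to
     multiples of elements of Z' of degree [e + 1], which are zero. *)
  apply: gB_sum => u; rewrite mem_mons => /eqP du.
  have: (0 < mdeg u)%N by rewrite du.
  have: gm_Z (gm_sub H) e ((f - \sum_i mfunX i (w i) : mfun n M) u) by exact: Bw.
  move: (_ u) => y Zy; rewrite -du.
  elim/mnm_add1_ind: u {du} => [|u i IHu] //; first by rewrite mdeg0.
  move=> _; rewrite mact_add1 -mactX mdegD mdeg1 addn1 addnS -addSn.
  by apply: mactB; apply: B1; exact: (gsub_X H).
rewrite (sub_morph_sum (gev_sub (M := M) _)); apply: gB_sum => i _.
rewrite gevX addnS; apply: gB_X; apply: IH.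
by have [] := Zw i.
Qed.

(** * Linear substitutions *)

Section LinearSubst.
Variable K : fieldType.

Lemma linear_formE n (c : 'rV[K]_n) i : (linear_form c)@_U_(i) = c 0 i.
Proof.
rewrite /linear_form raddf_sum (bigD1 i) //= big1 ?addr0 => [|j ji].
  by rewrite mcoeffZ mcoeffXU eqxx mulr1.
by rewrite mcoeffZ mcoeffXU (negbTE ji) mulr0.
Qed.

Lemma linear_form_inj n : injective (@linear_form K n).
Proof. by move=> a b e; apply/rowP => i; rewrite -!linear_formE e. Qed.

Lemma linear_form0 n : linear_form (0 : 'rV[K]_n) = 0.
Proof. by rewrite /linear_form big1 // => i _; rewrite mxE scale0r. Qed.

Lemma linear_form_homog n (c : 'rV[K]_n) : linear_form c \is 1.-homog.
Proof. by apply: rpred_sum => i _; apply: rpredZ; rewrite dhomogX /= mdeg1. Qed.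

Lemma linear_form_delta n (i : 'I_n) : linear_form (delta_mx 0 i : 'rV[K]_n) = 'X_i.
Proof.
rewrite /linear_form (bigD1 i) //= big1 ?addr0 => [|j ji]; rewrite mxE ?eqxx ?scale1r //.
by rewrite (negbTE ji) andbF scale0r.
Qed.

Section OneSubst.
Variables (n m : nat) (A : 'M[K]_(n, m)).
Implicit Types f g : {mpoly K[n]}.

Lemma linear_substD f g : linear_subst A (f + g) = linear_subst A f + linear_subst A g.
Proof. exact: comp_mpolyD. Qed.
Lemma linear_substB f g : linear_subst A (f - g) = linear_subst A f - linear_subst A g.
Proof. exact: comp_mpolyB. Qed.
Lemma linear_subst0 : linear_subst A 0 = 0.
Proof. exact: comp_mpoly0. Qed.
Lemma linear_substM f g : linear_subst A (f * g) = linear_subst A f * linear_subst A g.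
Proof. exact: rmorphM. Qed.
Lemma linear_substZ c f : linear_subst A (c *: f) = c *: linear_subst A f.
Proof. exact: comp_mpolyZ. Qed.
Lemma linear_substX i : linear_subst A 'X_i = linear_form (row i A).
Proof. by rewrite /linear_subst /comp_mpoly mmapX mmap1U tnth_mktuple. Qed.
Lemma linear_subst_sum (T : Type) (r : seq T) (P : pred T) (F : T -> {mpoly K[n]}) :
  linear_subst A (\sum_(t <- r | P t) F t) = \sum_(t <- r | P t) linear_subst A (F t).
Proof. exact: raddf_sum. Qed.

Lemma linear_subst_form (c : 'rV_n) : linear_subst A (linear_form c) = linear_form (c *m A).
Proof.
rewrite {1}/linear_form linear_subst_sum.
under eq_bigr do rewrite linear_substZ linear_substX scaler_sumr.
rewrite exchange_big; apply: eq_bigr => j _ /=; rewrite mxE scaler_suml.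
by apply: eq_bigr => i _; rewrite !mxE scalerA.
Qed.

Lemma mpoly_add1_ind (P : {mpoly K[n]} -> Prop) : P 1 ->
  (forall c f g, P f -> P g -> P (c *: f + g)) -> (forall f i, P f -> P ('X_i * f)) ->
  forall f, P f.
Proof.
move=> P1 PZ PX; have P0 : P 0 by have := PZ (-1) _ _ P1 P1; rewrite scaleN1r addNr.
have Pm u : P 'X_[u].
  elim/mnm_add1_ind: u => [|u i IH]; first by rewrite mpolyX0.
  by rewrite addmC mpolyXD; exact: PX.
by elim/mpolyind => // c u f _ _ Pf; exact: PZ.
Qed.

Lemma linear_subst_X_homog u : linear_subst A 'X_[u] \is (mdeg u).-homog.
Proof.
elim/mnm_add1_ind: u => [|u i IH].
  by rewrite mpolyX0 mdeg0 [linear_subst _ _]rmorph1 dhomog1.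
rewrite mpolyXD linear_substM mdegD mdeg1; apply: dhomogM => //.
by rewrite linear_substX linear_form_homog.
Qed.

Lemma linear_subst_pihomog d f : pihomog mdeg d (linear_subst A f) = linear_subst A (pihomog mdeg d f).
Proof.
rewrite {1}[f]mpolyE linear_subst_sum raddf_sum pihomogE linear_subst_sum [RHS]big_mkcond /=.
apply: eq_bigr => u _; rewrite !linear_substZ linearZ /=.
have h := linear_subst_X_homog u.
by case: eqP => [<-|/eqP ne]; [rewrite pihomog_dE|rewrite (pihomog_ne0 ne h) scaler0].
Qed.

Lemma linear_subst_homog d f : f \is d.-homog -> linear_subst A f \is d.-homog.
Proof. by move/pihomog_dE => <-; rewrite -linear_subst_pihomog pihomogP. Qed.

Lemma linear_subst_msupp f u : u \in msupp (linear_subst A f) ->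
  exists2 w, w \in msupp f & mdeg w = mdeg u.
Proof.
rewrite {1}[f]mpolyE linear_subst_sum => /msupp_sum_le /flattenP[s /mapP[w]].
rewrite filter_predT => fw -> ; rewrite linear_substZ => /msuppZ_le hu.
have /= e := dhomog_mf (linear_subst_X_homog w) hu; exists w; first exact: fw. by rewrite e.
Qed.

Lemma linear_subst_coef0 f : (linear_subst A f)@_0%MM = f@_0%MM.
Proof.
elim/mpoly_add1_ind: f => [|c f g Hf Hg|f i _].
- by rewrite [linear_subst _ _]rmorph1 !mcoeff1 !eqxx.
- by rewrite linear_substD linear_substZ !mcoeffD !mcoeffZ Hf Hg.
rewrite linear_substM linear_substX ![(_ * _)@_0]rmorphM /= mcoeffX mnm1_eq0 mul0r.
by rewrite (dhomog_nemf_coeff (linear_form_homog _)) ?mul0r //= mdeg0.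
Qed.

End OneSubst.

Lemma linear_subst_comp n m p (A : 'M[K]_(n, m)) (B : 'M[K]_(m, p)) f :
  linear_subst B (linear_subst A f) = linear_subst (A *m B) f.
Proof.
elim/mpoly_add1_ind: f => [|c f g Hf Hg|f i Hf].
- by rewrite ![linear_subst _ 1]rmorph1.
- by rewrite !linear_substD !linear_substZ Hf Hg.
- by rewrite !linear_substM Hf !linear_substX linear_subst_form row_mul.
Qed.

Lemma linear_subst_id n f : linear_subst (1%:M : 'M[K]_n) f = f.
Proof.
elim/mpoly_add1_ind: f => [|c f g Hf Hg|f i Hf].
- exact: rmorph1.
- by rewrite !linear_substD !linear_substZ Hf Hg.
- by rewrite !linear_substM Hf !linear_substX row1 linear_form_delta.
Qed.

Lemma linear_substK n (g : 'M[K]_n) : g \in unitmx -> cancel (linear_subst g) (linear_subst (invmx g)).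
Proof. by move=> Ug f; rewrite linear_subst_comp mulmxV // linear_subst_id. Qed.
Lemma linear_substVK n (g : 'M[K]_n) : g \in unitmx -> cancel (linear_subst (invmx g)) (linear_subst g).
Proof. by move=> Ug f; rewrite linear_subst_comp mulVmx // linear_subst_id. Qed.

(** The quotient map by x_0; its section [incl0] guarantees that images of ideals are ideals. *)
Definition kill0 n : 'M[K]_(n.+1, n) := (col_mx 0 1%:M : 'M_(1 + n, n)).
Definition incl0 n : 'M[K]_(n, n.+1) := (row_mx 0 1%:M : 'M_(n, 1 + n)).

Lemma incl_kill n : incl0 n *m kill0 n = 1%:M.
Proof. by rewrite [LHS](@mul_row_col _ n 1 n n) mul0mx mul1mx add0r. Qed.

Lemma kill0_ord0 n : linear_subst (kill0 n) 'X_ord0 = 0.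
Proof.
rewrite linear_substX (_ : row _ _ = 0) ?linear_form0 //; apply/rowP => j.
by rewrite mxE (_ : ord0 = lshift n (ord0 : 'I_1)) ?[LHS]col_mxEu ?mxE //; apply: val_inj.
Qed.

Lemma kill0_lift n i : linear_subst (kill0 n) 'X_(lift ord0 i) = 'X_i.
Proof.
rewrite linear_substX -[RHS]linear_form_delta; congr linear_form; apply/rowP => j.
rewrite mxE (_ : lift ord0 i = rshift 1 i) ?[LHS]col_mxEd ?mxE //; last by apply: val_inj.
by rewrite eq_sym.
Qed.

Lemma kill0_coef n f u : (linear_subst (kill0 n) f)@_u = f@_(minc u).
Proof.
suff H w : linear_subst (kill0 n) 'X_[w] = if w ord0 == 0%N then 'X_[mres w] else 0.
  rewrite {1}[f]mpolyE linear_subst_sum raddf_sum /=.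
  have [uf|uf] := boolP (minc u \in msupp f); last first.
    rewrite (memN_msupp_eq0 uf) big1_seq // => w /= wf.
    rewrite linear_substZ H mcoeffZ; case: eqP => w0; last by rewrite mcoeff0 mulr0.
    rewrite mcoeffX; case: eqP => [e|]; last by rewrite mulr0.
    by move: uf; rewrite -e mresK // wf.
  rewrite (bigD1_seq (minc u)) ?msupp_uniq //= big1 ?addr0 => [|w wu].
    by rewrite linear_substZ H minc_ord0 eqxx mincK mcoeffZ mcoeffX eqxx mulr1.
  rewrite linear_substZ H mcoeffZ; case: eqP => w0; last by rewrite mcoeff0 mulr0.
  rewrite mcoeffX; case: eqP => [e|]; last by rewrite mulr0.
  by move: wu; rewrite -e mresK // eqxx.
have HX u' : linear_subst (kill0 n) 'X_[minc u'] = 'X_[u'].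
  elim/mnm_add1_ind: u' => [|u' i IH]; first by rewrite minc0 !mpolyX0 [LHS]rmorph1.
  by rewrite minc_add1 !mpolyXD linear_substM IH kill0_lift.
case: eqP => [w0|/eqP w0]; first by rewrite -{1}(mresK w0) HX.
have le : (U_(ord0) <= w)%MM by rewrite lep1mP.
by rewrite -(submK le) mpolyXD linear_substM kill0_ord0 mulr0.
Qed.

Lemma kill0_eq0 n (f : {mpoly K[n.+1]}) : linear_subst (kill0 n) f = 0 -> exists q, f = 'X_ord0 * q.
Proof.
move=> f0; exists (\sum_(w <- msupp f) f@_w *: 'X_[w - U_(ord0)]).
rewrite {1}[f]mpolyE mulr_sumr; apply: eq_big_seq => w wf; rewrite -scalerAr -mpolyXD.
rewrite addmC submK // lep1mP; apply: contraTneq wf => w0.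
by rewrite mcoeff_msupp -(mresK w0) -kill0_coef f0 mcoeff0 eqxx.
Qed.

End LinearSubst.

(** * Ideals as graded modules *)

Section IdealModule.
Variable K : fieldType.

Section Basics.
Variables (n : nat) (J : {mpoly K[n]} -> Prop).
Hypothesis HJ : is_ideal J.

Lemma ideal_opp f : J f -> J (- f).
Proof. by move=> Jf; rewrite -mulN1r; exact: ideal_mull. Qed.
Lemma ideal_sub f g : J f -> J g -> J (f - g).
Proof. by move=> Jf Jg; apply: ideal_add => //; exact: ideal_opp. Qed.
Lemma ideal_scale c f : J f -> J (c *: f).
Proof. by move=> Jf; rewrite -mul_mpolyC; exact: ideal_mull. Qed.
Lemma ideal_sum (T : eqType) (r : seq T) (F : T -> {mpoly K[n]}) :
  (forall t, t \in r -> J (F t)) -> J (\sum_(t <- r) F t).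
Proof. by apply: sub_closed_sum => [|u v]; [exact: ideal_zero|exact: ideal_sub]. Qed.

Lemma idmod_axioms : gmod_axioms (fun i f => 'X_i * f)
  (fun k f => J f /\ f \is k.-homog) (fun _ f => f = 0).
Proof.
split=> //.
- by move=> i u v; rewrite mulrBr.
- by move=> i j v; rewrite mulrCA.
- by move=> _ u v -> ->; rewrite subr0.
- by move=> _ i v ->; rewrite mulr0.
- by move=> k u v [Ju hu] [Jv hv]; split; [exact: ideal_sub|exact: rpredB].
- move=> k i v [Jv hv]; split; first exact: ideal_mull.
  by rewrite -(add1n k); apply: dhomogM => //; rewrite dhomogX /= mdeg1.
- by move=> k v ->; split; [exact: ideal_zero|exact: dhomog0].
Qed.
Definition idmod : gmodule n := Gmodule idmod_axioms.

End Basics.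

Lemma lin_same_ideal t n (J J' : {mpoly K[n]} -> Prop) (HJ : is_ideal J) (HJ' : is_ideal J') d :
  same_ideal J J' -> lin t (idmod HJ) d -> lin t (idmod HJ') d.
Proof.
move=> S; have h : gm_iso (M := idmod HJ) (N := idmod HJ') id.
  split=> //; first by move=> k v [/S].
  by move=> k w [/S Jw hw]; exists w => //; rewrite subrr.
by rewrite (lin_iso t d h).
Qed.

Lemma ideal_image_ideal n m (A : 'M[K]_(n, m)) (B : 'M[K]_(m, n)) (J : {mpoly K[n]} -> Prop) :
  B *m A = 1%:M -> is_ideal J -> is_ideal (ideal_image A J).
Proof.
move=> BA HJ; split.
- by exists 0; [exact: ideal_zero|rewrite linear_subst0].
- move=> _ _ [f Jf ->] [g Jg ->]; exists (f + g); first exact: ideal_add.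
  by rewrite linear_substD.
- move=> a _ [f Jf ->]; exists (linear_subst B a * f); first exact: ideal_mull.
  by rewrite linear_substM linear_subst_comp BA linear_subst_id.
Qed.

Lemma ideal_image_homogeneous n m (A : 'M[K]_(n, m)) (B : 'M[K]_(m, n)) J :
  B *m A = 1%:M -> homogeneous_ideal J -> homogeneous_ideal (ideal_image A J).
Proof.
move=> BA [HJ hJ]; split; first exact: ideal_image_ideal BA HJ.
move=> _ d [f Jf ->]; exists (pihomog mdeg d f); first exact: hJ.
by rewrite linear_subst_pihomog.
Qed.

(** * The section of an ideal by the hyperplane x_0 = 0 *)

Section HyperplaneSection.
Variables (n d : nat) (J : {mpoly K[n.+1]} -> Prop).
Hypothesis hJ : homogeneous_ideal J.
Let HJ : is_ideal J := proj1 hJ.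
Let HJ0 : is_ideal (ideal_image (kill0 K n) J) := ideal_image_ideal (incl_kill K n) HJ.
Let M := idmod HJ.

Lemma idmod_regular : X0_regular M.
Proof. by move=> k v _ /= /eqP; rewrite mulf_eq0 => /orP[|/eqP //]; rewrite -msize_poly_eq0 msizeX. Qed.

(** The kernel of J/x_0 J -> R/x_0 R: it is (J meet x_0 R)/x_0 J, that is, (J : x_0)/J shifted by
    one degree. *)
Definition x0_part k (f : gm_red M) := (J f /\ f \is k.-homog) /\ linear_subst (kill0 K n) f = 0.

Lemma x0_part_submodule : @gm_submodule n (gm_red M) x0_part.
Proof.
split.
- move=> k u v [Zu u0] [Zv v0]; split; first exact: (@gZ_sub _ M).
  by rewrite linear_substB u0 v0 subr0.
- move=> k i v [Zv v0]; split; first exact: (@gZ_X _ M _ (lift ord0 i)).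
  by rewrite linear_substM v0 mulr0.
- move=> k v Bv; split; first exact: (@gBZ _ (gm_red M)).
  case: k Bv => [->|k [z _ /= /eqP]]; first exact: linear_subst0.
  by rewrite subr_eq0 => /eqP ->; rewrite linear_substM kill0_ord0 mul0r.
- by move=> k v [].
Qed.

Lemma x0_part_quo_iso : gm_iso (M := gm_quo x0_part_submodule) (N := idmod HJ0) (linear_subst (kill0 K n)).
Proof.
split.
- by move=> u v; exact: linear_substB.
- by move=> i v /=; rewrite linear_substM kill0_lift.
- by move=> k v [Jv hv]; split; [exists v|exact: linear_subst_homog].
- by move=> k v [].
- by move=> k v Zv /= v0; split.
- move=> k w [[f Jf ->] hw]; exists (pihomog mdeg k f).
    by split; [apply: (proj2 hJ)|exact: pihomogP].
  by rewrite /= -linear_subst_pihomog pihomog_dE // subrr.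
Qed.

Lemma homog_X0_div k q : 'X_ord0 * q \is k.+1.-homog -> (q : {mpoly K[n.+1]}) \is k.-homog.
Proof.
move/dhomogP => h; apply/dhomogP => u; rewrite mcoeff_msupp => qu; apply/eqP.
have := h (U_(ord0) + u)%MM; rewrite mcoeff_msupp mulrC mcoeffMX qu => /(_ isT) /=.
by rewrite mdegD mdeg1 add1n => -[->].
Qed.

Lemma x0_partP k : (forall f, f \is k.-homog -> J ('X_ord0 * f) -> J f) ->
  forall v, x0_part k.+1 v -> gm_B (gm_red M) k.+1 v.
Proof.
move=> col v [[Jv hv] /kill0_eq0[q def_v]]; rewrite def_v in Jv hv.
have hq := homog_X0_div hv; exists q; first by split=> //; exact: col.
by rewrite /= def_v subrr.
Qed.

(** J vanishes below [d], so the kernel is concentrated in degree [d]. *)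
Lemma x0_part_lin : gen_in M d ->
  (forall k v, (d < k)%N -> x0_part k v -> gm_B (gm_red M) k v) ->
  forall t, lin t (gm_sub x0_part_submodule) d.
Proof.
move=> [G _] Bx t; apply: lin_conc => k v kd Zv.
have [lt|lt|/kd//] := ltngtP k d; last exact: Bx.
by apply: redBW; apply: G lt _; case: Zv.
Qed.

(** The colon condition, in the single degree [d], kills the kernel in degree [d + 1]; linearity of
    the image then kills it in all higher degrees. *)
Lemma lin_of_hyperplane_section : gen_in M d ->
  (forall f, f \is d.-homog -> J ('X_ord0 * f) -> J f) ->
  (forall t, lin t (idmod HJ0) d) -> forall t, lin t M d.
Proof.
move=> G col L t; apply/(lin_red t d idmod_regular).
have Lq s : lin s (gm_quo x0_part_submodule) d by apply/(lin_iso _ _ x0_part_quo_iso).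
apply/(lin_ses (H := x0_part_submodule)) => //; apply: x0_part_lin => // k v.
apply: (submodule_vanishes_above (H := x0_part_submodule)); [exact/red_gen_in|exact: Lq|].
exact: x0_partP.
Qed.

Lemma hyperplane_section_lin : (forall t, lin t M d) ->
  (exists e, forall k f, (e <= k)%N -> f \is k.-homog -> J ('X_ord0 * f) -> J f) ->
  (forall k f, (d <= k)%N -> f \is k.-homog -> J ('X_ord0 * f) -> J f) /\
  forall t, lin t (idmod HJ0) d.
Proof.
move=> L [e col].
have Lr t : lin t (gm_red M) d by apply/(lin_red t d idmod_regular).
(* Descending induction from the degree beyond which the kernel vanishes: if its next degree is
   zero, its elements belong to the socle of J/x_0 J. *)
have top j : forall k v, (d < k)%N -> (e < k + j)%N -> x0_part k v -> gm_B (gm_red M) k v.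
  elim: j => [|j IH] k v dk ek Zv.
    case: k dk ek Zv => // k dk; rewrite addn0 ltnS => ek Zv.
    by apply: x0_partP Zv => f; exact: col.
  apply: (lin_socle Lr) => //; first by case: Zv.
  by move=> i; apply: IH; [lia|lia|exact: (gsub_X x0_part_submodule)].
have Bx k v : (d < k)%N -> x0_part k v -> gm_B (gm_red M) k v.
  by move=> dk; apply: (top e.+1) => //; lia.
split=> [k f dk hf Jf|t].
  have hxf : 'X_ord0 * f \is k.+1.-homog.
    by rewrite -(add1n k); apply: dhomogM => //; rewrite dhomogX /= mdeg1.
  have [] := Bx k.+1 ('X_ord0 * f); first by lia.
    by split; [split|rewrite linear_substM kill0_ord0 mul0r].
  move=> z [Jz _] /= /eqP; rewrite -mulrBr mulf_eq0 subr_eq0.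
  by case/orP => [|/eqP ->//]; rewrite -msize_poly_eq0 msizeX.
have G : gen_in M d by case: (L 1%N).
by apply/(lin_iso _ _ x0_part_quo_iso)/(lin_ses (H := x0_part_submodule)); [exact: x0_part_lin|].
Qed.

End HyperplaneSection.
End IdealModule.

(** * Graded submodules of free modules *)

Section Projections.
Variables (K : fieldType) (n : nat).
Local Notation R := {mpoly K[n]}.

Lemma pihomogMr k l (p q : R) : q \is k.-homog ->
  pihomog mdeg (l + k) (p * q) = pihomog mdeg l p * q.
Proof.
move=> hq; have le : (msize p <= maxn (msize p) l.+1)%N by rewrite leq_maxl.
have lt : (l < maxn (msize p) l.+1)%N by rewrite leq_maxr.
rewrite {1}(pihomog_partitionE le) mulr_suml raddf_sum (bigD1 (Ordinal lt)) //= big1 ?addr0.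
  by rewrite pihomog_dE //; apply: dhomogM => //; exact: pihomogP.
move=> j jl; apply: (@pihomog_ne0 _ _ _ (j + k)%N).
  by rewrite eqn_add2r; apply: contra jl => /eqP jl; apply/eqP/val_inj.
by apply: dhomogM => //; exact: pihomogP.
Qed.

Lemma pihomogMr_low k l (p q : R) : q \is k.-homog -> (l < k)%N -> pihomog mdeg l (p * q) = 0.
Proof.
move=> hq lk; rewrite {1}(pihomog_partitionE (leqnn (msize p))) mulr_suml raddf_sum big1 //= => j _.
apply: (@pihomog_ne0 _ _ _ (j + k)%N); first by lia.
by apply: dhomogM => //; exact: pihomogP.
Qed.

(** Basis degrees of a free complex are arbitrary integers, so differences of degrees may be
    negative; the component there is 0. *)
Definition iproj (z : int) (p : R) : R := if z is Posz k then pihomog mdeg k p else 0.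

Definition ihomog (z : int) (p : R) := forall m, m \in msupp p -> (mdeg m)%:Z = z.

Lemma iprojP z p : ihomog z (iproj z p).
Proof.
case: z => k m /=; last by rewrite msupp0.
by move=> /(dhomog_mf (pihomogP _ _ _)) /= ->.
Qed.

Lemma iproj_sum z (T : Type) (r : seq T) (F : T -> R) :
  iproj z (\sum_(t <- r) F t) = \sum_(t <- r) iproj z (F t).
Proof. by case: z => k /=; [exact: raddf_sum|rewrite big1]. Qed.

Lemma ihomog_nat k p : ihomog (Posz k) p <-> p \is k.-homog.
Proof. by split=> [h|/dhomogP h]; [apply/dhomogP => m /h []|move=> m /h /= ->]. Qed.

Lemma ihomogP z p : ihomog z p -> p = 0 \/ exists2 k, z = Posz k & p \is k.-homog.
Proof.
move=> h; have [->|p0] := eqVneq p 0; [by left|right].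
exists (mdeg (mlead p)); first by rewrite (h _ (mlead_supp p0)).
by apply/ihomog_nat; rewrite (h _ (mlead_supp p0)).
Qed.

Lemma iproj_id z p : ihomog z p -> iproj z p = p.
Proof.
by move/ihomogP => [->|[k -> /pihomog_dE //]]; case: z => k //=; rewrite pihomog0.
Qed.

Lemma iprojMr z y p q : ihomog y q -> iproj (z + y) (p * q) = iproj z p * q.
Proof.
case/ihomogP => [->|[k -> hq]].
  by rewrite !mulr0; case: (z + y) => l //=; rewrite pihomog0.
case: z => l /=; first exact: pihomogMr.
rewrite mul0r NegzE; case E: (_ + _)%R => [a|a] //=.
by apply: (pihomogMr_low _ hq); lia.
Qed.

Definition mx_homog s r (delta : 'I_s -> int) (eps : 'I_r -> int) (D : 'M[R]_(s, r)) :=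
  forall a b, ihomog (delta a - eps b) (D a b).

Definition vproj s (delta : 'I_s -> int) (k : int) (v : 'rV[R]_s) : 'rV[R]_s :=
  \row_a iproj (k - delta a) (v 0 a).

Definition vhomog s (delta : 'I_s -> int) (k : int) (v : 'rV[R]_s) :=
  forall a, ihomog (k - delta a) (v 0 a).

Lemma vprojP s (delta : 'I_s -> int) k v : vhomog delta k (vproj delta k v).
Proof. by move=> a; rewrite mxE; exact: iprojP. Qed.

Lemma vproj_id s (delta : 'I_s -> int) k v : vhomog delta k v -> vproj delta k v = v.
Proof. by move=> h; apply/rowP => a; rewrite mxE iproj_id. Qed.

Section VecHomog.
Variables (s r : nat) (delta : 'I_s -> int) (eps : 'I_r -> int) (D : 'M[R]_(s, r)).

Hypothesis hD : mx_homog delta eps D.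

Lemma vproj_mul k v : vproj eps k (v *m D) = vproj delta k v *m D.
Proof.
apply/rowP => b; rewrite !mxE iproj_sum; apply: eq_bigr => a _; rewrite mxE.
by rewrite -(iprojMr _ _ (@hD a b)); congr (iproj _ _); ring.
Qed.

Lemma vhomog_mul k v : vhomog delta k v -> vhomog eps k (v *m D).
Proof. by move=> h; rewrite -(vproj_id h) -vproj_mul; exact: vprojP. Qed.

(** The component of degree [k] of any lift is again a lift. *)
Lemma vhomog_lift k v : vhomog eps k v -> (exists w, v = w *m D) ->
  exists2 w, vhomog delta k w & v = w *m D.
Proof.
move=> h [w def_v]; exists (vproj delta k w); first exact: vprojP.
by rewrite -vproj_mul -def_v vproj_id.
Qed.

End VecHomog.

Lemma vproj_sum s (delta : 'I_s -> int) (k : int) (T : Type) (l : seq T) (F : T -> 'rV[R]_s) :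
  vproj delta k (\sum_(t <- l) F t) = \sum_(t <- l) vproj delta k (F t).
Proof.
apply/rowP => a; rewrite mxE !summxE iproj_sum.
by apply: eq_bigr => t _; rewrite mxE.
Qed.

Lemma vprojZX s (delta : 'I_s -> int) (k : int) i v :
  vproj delta (k + 1) ('X_i *: v) = 'X_i *: vproj delta k v.
Proof.
have hX : ihomog 1 ('X_i : R) by move=> m; rewrite msuppX inE => /eqP ->; rewrite mdeg1.
apply/rowP => a; rewrite !mxE [RHS]mulrC -(iprojMr _ _ hX) [v 0 a * _]mulrC.
by congr (iproj _ _); ring.
Qed.

Definition deg0 s : 'I_s -> int := fun _ => 0.

Lemma vhomog_nat s k (v : 'rV[R]_s) : vhomog (@deg0 s) (Posz k) v <-> forall a, v 0 a \is k.-homog.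
Proof. by split=> h a; move: (h a); rewrite subr0 ihomog_nat. Qed.

Lemma vproj_sum_all s (v : 'rV[R]_s) : exists N, v = \sum_(k < N) vproj (@deg0 s) (Posz k) v.
Proof.
exists (\max_a msize (v ord0 a))%N; apply/rowP => a; rewrite summxE.
rewrite {1}(@pihomog_partitionE _ _ mdeg (\max_a msize (v ord0 a))%N (v 0 a)); last exact: (leq_bigmax a).
by apply: eq_bigr => k _; rewrite mxE subr0.
Qed.

Record graded_sub r (S : 'rV[R]_r -> Prop) : Prop := GradedSub {
  gs_zero : S 0;
  gs_add : forall u v, S u -> S v -> S (u + v);
  gs_scale : forall a u, S u -> S (a *: u);
  gs_proj : forall k u, S u -> S (vproj (@deg0 r) (Posz k) u) }.

Section VecModule.
Variables (r : nat) (S : 'rV[R]_r -> Prop).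
Hypothesis HS : graded_sub S.

Lemma gs_sub u v : S u -> S v -> S (u - v).
Proof. by move=> Su Sv; rewrite -scaleN1r; apply: gs_add => //; exact: gs_scale. Qed.

Lemma gs_sum (T : eqType) (l : seq T) (F : T -> 'rV[R]_r) :
  (forall t, t \in l -> S (F t)) -> S (\sum_(t <- l) F t).
Proof. by apply: sub_closed_sum => [|u v]; [exact: gs_zero|exact: gs_sub]. Qed.

Lemma gs_mulmx s (D : 'M[R]_(s, r)) (w : 'rV[R]_s) : (forall j, S (row j D)) -> S (w *m D).
Proof. by move=> h; rewrite mulmx_sum_row; apply: gs_sum => j _; exact: gs_scale. Qed.

Lemma vmod_axioms : gmod_axioms (fun i v => 'X_i *: v)
  (fun k v => S v /\ forall a, v 0 a \is k.-homog) (fun _ v => v = 0).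
Proof.
split=> //.
- by move=> i u v; rewrite scalerBr.
- by move=> i j v; rewrite !scalerA mulrC.
- by move=> _ u v -> ->; rewrite subr0.
- by move=> _ i v ->; rewrite scaler0.
- move=> k u v [Su hu] [Sv hv]; split; first exact: gs_sub.
  by move=> a; rewrite !mxE; exact: rpredB.
- move=> k i v [Sv hv]; split; first exact: gs_scale.
  by move=> a; rewrite mxE -(add1n k); apply: dhomogM => //; rewrite dhomogX /= mdeg1.
- by move=> k v ->; split=> [|a]; [exact: gs_zero|rewrite mxE dhomog0].
Qed.
Definition vmod : gmodule n := Gmodule vmod_axioms.

Lemma vmod_mact u (v : vmod) : mact u v = 'X_[u] *: (v : 'rV[R]_r).
Proof.
elim/mnm_add1_ind: u => [|u i IH]; first by rewrite mact0 mpolyX0 scale1r.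
by rewrite mact_add1 IH /= scalerA addmC mpolyXD.
Qed.

End VecModule.

Lemma ker_graded_sub s r (D : 'M[R]_(s, r)) e :
  (forall a b, D a b \is e.-homog) -> graded_sub (fun v : 'rV[R]_s => v *m D = 0).
Proof.
move=> hD; split.
- by rewrite mul0mx.
- by move=> u v Hu Hv; rewrite mulmxDl Hu Hv addr0.
- by move=> a u Hu; rewrite -scalemxAl Hu scaler0.
(* Placing the target basis in degree [-e] turns [D] into a map of degree 0. *)
- have hD' : mx_homog (@deg0 s) (fun _ : 'I_r => - e%:Z) D.
    by move=> a b; rewrite sub0r opprK ihomog_nat.
  move=> k u Hu; rewrite -(vproj_mul hD') Hu; apply/rowP => b; rewrite !mxE.
  by rewrite /iproj; case: (_ - _) => // l; rewrite pihomog0.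
Qed.

End Projections.
Arguments deg0 {s}.

(** * Bases of graded pieces *)

(** [S] is a mere predicate, so a free family is enlarged by excluded middle as long as its span
    misses an element of [S]; the ambient dimension bounds the number of enlargements. *)
Lemma subspace_basis (K : fieldType) N (S : 'rV[K]_N -> Prop) :
  (forall u v a, S u -> S v -> S (a *: u + v)) ->
  exists s (D : 'M[K]_(s, N)), [/\ row_free D, forall i, S (row i D) &
    forall v, S v -> (v <= D)%MS].
Proof.
move=> SD.
suff H m s (D : 'M[K]_(s, N)) : (N - s <= m)%N -> row_free D -> (forall i, S (row i D)) ->
    exists s (D : 'M[K]_(s, N)), [/\ row_free D, forall i, S (row i D) &
      forall v, S v -> (v <= D)%MS].
  by apply: (H N 0%N (0 : 'M_(0, N))); rewrite ?leq_subr // /row_free ?mxrank0 // => -[].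
elim: m s D => [|m IH] s D le fD SrD.
all: case: (classic (exists v, S v /\ ~~ (v <= D)%MS)) => [[v [Sv vD]]|h].
2,4: by exists s, D; split=> // v Sv; apply: contra_notT h => vD; exists v.
all: have fD' : row_free (col_mx v D).
1,3: apply: inj_row_free => w; rewrite -(hsubmxK w) mul_row_col; set a := lsubmx w; set b := rsubmx w.
1,2: have [a0|a0] := eqVneq (a 0 0) 0.
1,3: have -> : a = 0 by apply/rowP => i; rewrite ord1 a0 mxE.
1,2: by rewrite mul0mx add0r -(mul0mx _ D) => /(row_free_inj fD) ->; rewrite row_mx0.
1,2: move=> /eqP; rewrite addr_eq0 => /eqP e; case/negP: vD; apply/submxP.
1,2: exists (- (a 0 0)^-1 *: b); rewrite -scalemxAl scaleNr -scalerN -e [a]mx11_scalar mul_scalar_mx.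
1,2: by rewrite scalerA mxE eqxx mulr1n mulVf // scale1r.
- have := rank_leq_col (col_mx v D); have /eqP -> := fD'.
  by move: le; rewrite leqn0 subn_eq0 => le1 le2; have := leq_trans le2 le1; rewrite ltnn.
- apply: (IH _ (col_mx v D)) => // [|i]; first by lia.
  rewrite -(splitK i); case: (split i) => j /=; last by rewrite rowKd.
  by rewrite rowKu row_id.
Qed.

Section GradedBasis.
Variables (K : fieldType) (n : nat).
Local Notation R := {mpoly K[n]}.
Local Notation Cmx := (map_mx (@mpolyC n K)).

Lemma graded_basis r (S : 'rV[R]_r -> Prop) (HS : graded_sub S) e :
  exists s (D : 'M[R]_(s, r)), [/\ forall j, gm_Z (vmod HS) e (row j D),
    forall c : 'rV[K]_s, Cmx c *m D = 0 -> c = 0 &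
    forall v, gm_Z (vmod HS) e v -> exists c : 'rV[K]_s, v = Cmx c *m D].
Proof.
(* A vector of degree [e] is determined by finitely many coefficients, indexed by a position and a
   monomial of degree at most [e]. *)
pose T : finType := ('I_r * 'X_{1..n < e.+1})%type.
pose dc (c : 'rV[K]_#|T|) : 'rV[R]_r :=
  \row_a \sum_(u : 'X_{1..n < e.+1}) c 0 (enum_rank (a, u)) *: 'X_[u].
pose co (v : 'rV[R]_r) : 'rV[K]_#|T| :=
  \row_i (let: (a, u) := enum_val i : T in (v 0 a)@_(val u)).
have dcK : cancel dc co.
  move=> c; apply/rowP => i; rewrite mxE; case E: (enum_val i) => [a u].
  rewrite mxE raddf_sum (bigD1 u) //= big1 ?addr0 => [|w wu].
    by rewrite mcoeffZ mcoeffX eqxx mulr1 -E enum_valK.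
  by rewrite mcoeffZ mcoeffX (_ : (_ == _) = false) ?mulr0 //; apply: contraNF wu => /eqP/val_inj ->.
have coK (v : 'rV[R]_r) : (forall a, v 0 a \is e.-homog) -> dc (co v) = v.
  move=> hv; apply/rowP => a; rewrite mxE [RHS](@mpolywE _ _ e.+1).
    by apply: eq_bigr => u _; rewrite mxE enum_rankK.
  rewrite msizeE; apply/bigmax_leqP_seq => m mv _; rewrite ltnS.
  by have /= -> := dhomog_mf (hv a) mv.
have dcD a u v : dc (a *: u + v) = a%:MP *: dc u + dc v.
  apply/rowP => i; rewrite !mxE mulr_sumr -big_split /=; apply: eq_bigr => w _.
  by rewrite !mxE scalerDl mul_mpolyC scalerA.
have dc0 : dc 0 = 0 by apply/rowP => i; rewrite !mxE big1 // => w _; rewrite mxE scale0r.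
have [|s [D [fD rD sD]]] := @subspace_basis K _ (fun c => gm_Z (vmod HS) e (dc c)).
  move=> u v a [Su hu] [Sv hv]; rewrite dcD; split.
    by apply: gs_add => //; exact: gs_scale.
  by move=> i; rewrite mxE; apply: rpredD => //; rewrite mxE mul_mpolyC; exact: rpredZ.
have dcM (c : 'rV[K]_s) : dc (c *m D) = Cmx c *m \matrix_j dc (row j D).
  rewrite [c *m D]mulmx_sum_row mulmx_sum_row.
  have dcs (l : seq 'I_s) : dc (\sum_(j <- l) c 0 j *: row j D) =
      \sum_(j <- l) Cmx c 0 j *: row j (\matrix_j dc (row j D)).
    by elim: l => [|j l IH]; rewrite ?big_nil // !big_cons dcD IH mxE rowK.
  exact: dcs.
exists s, (\matrix_j dc (row j D)); split.
- by move=> j; rewrite rowK; exact: rD.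
- move=> c; rewrite -dcM => /(congr1 co); rewrite dcK => e0.
  have e1 : co 0 = 0 by rewrite -dc0 dcK.
  by apply: (row_free_inj fD); rewrite e0 e1 mul0mx.
- move=> v [Sv hv]; have := sD (co v); rewrite coK // => /(_ (conj Sv hv)) /submxP[c def_c].
  by exists c; rewrite -dcM -def_c coK.
Qed.

Lemma mcoeffXM i (p : R) u : ('X_i * p)@_u = if (0 < u i)%N then p@_(u - U_(i)) else 0.
Proof.
rewrite mulrC; case: ifP => [ui|/negbT].
  have le : (U_(i) <= u)%MM by rewrite lep1mP -lt0n.
  by rewrite -{1}(submK le) addmC mcoeffMX.
rewrite -eqn0Ngt => /eqP ui; apply/eqP; rewrite mcoeff_eq0; apply/negP.
rewrite (perm_mem (msuppMX _ _)) => /mapP[w _ def_u].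
by move: ui; rewrite def_u mnmDE mnm1E eqxx.
Qed.

Lemma homog_sum_mons j (p : R) : p \is j.-homog -> p = \sum_(u <- mons n j) p@_u *: 'X_[u].
Proof.
move=> hp; rewrite {1}[p]mpolyE [RHS](bigID (fun u => u \in msupp p)) /=.
rewrite [X in _ + X]big1 ?addr0 => [|u]; last by move/memN_msupp_eq0 ->; rewrite scale0r.
rewrite -[RHS]big_filter; apply: perm_big; apply: uniq_perm => [||u].
- exact: msupp_uniq.
- by rewrite filter_uniq ?uniq_mons.
rewrite mem_filter mem_mons; case: (boolP (u \in msupp p)) => //= up.
by have /= -> := dhomog_mf hp up; rewrite eqxx.
Qed.

Lemma map_CmxE r (c : 'rV[K]_r) u : map_mx (mcoeff u) (Cmx c) = if u == 0%MM then c else 0.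
Proof.
apply/rowP => a; rewrite !mxE mcoeffC; case: eqP => _; first by rewrite mulr1.
by rewrite mulr0 mxE.
Qed.

(** A K-basis of S_e identifies R tensor S_e with R^s: the coefficient of x^u in a vector is the
    coordinate row of the value at u. Syzygies become the kernel of [D]. *)
Lemma syz_basis_iso r (S : 'rV[R]_r -> Prop) (HS : graded_sub S) e s (D : 'M[R]_(s, r))
    (Hk : graded_sub (fun v : 'rV[R]_s => v *m D = 0)) :
  (forall j, gm_Z (vmod HS) e (row j D)) ->
  (forall c : 'rV[K]_s, Cmx c *m D = 0 -> c = 0) ->
  (forall v, gm_Z (vmod HS) e v -> exists c : 'rV[K]_s, v = Cmx c *m D) ->
  gm_iso (M := vmod Hk) (N := syz (vmod HS) e)
    (fun v u => Cmx (map_mx (mcoeff u) (v : 'rV[R]_s)) *m D).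
Proof.
move=> rD iD sD.
have gevE j (v : 'rV[R]_s) : (forall a, v 0 a \is j.-homog) ->
    gev (M := vmod HS) j (fun u => Cmx (map_mx (mcoeff u) v) *m D) = v *m D.
  move=> hv; rewrite /gev; under eq_bigr do rewrite vmod_mact scalemxAl.
  rewrite -mulmx_suml; congr (_ *m D); apply/rowP => a; rewrite summxE [RHS](homog_sum_mons (hv a)).
  by apply: eq_bigr => u _; rewrite !mxE mulrC mul_mpolyC.
have ZD (c : 'rV[K]_s) : gm_Z (vmod HS) e (Cmx c *m D).
  rewrite mulmx_sum_row; apply: (@gZ_sum _ (vmod HS)) => j _.
  have [Sj hj] := rD j; split; first exact: gs_scale.
  by move=> a; rewrite mxE (mxE _ _ 0 j) mul_mpolyC; apply: rpredZ; exact: hj.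
split.
- move=> u v; apply: functional_extensionality => w.
  by rewrite raddfB /= map_mxB mulmxBl.
- move=> i v; apply: functional_extensionality => u; rewrite /= /mfunX.
  case: ifP => ui; last rewrite (_ : map_mx _ _ = 0) ?map_mx0 ?mul0mx //.
    by congr (Cmx _ *m D); apply/rowP => a; rewrite !mxE mcoeffXM ui.
  by apply/rowP => a; rewrite !mxE mcoeffXM ui.
- move=> j v [vD hv]; split=> [u du|u|]; last by rewrite gevE.
    rewrite (_ : map_mx _ _ = 0) ?map_mx0 ?mul0mx //; apply/rowP => a; rewrite !mxE.
    by rewrite (dhomog_nemf_coeff (hv a)) ?mpolyC0 //=; apply/eqP.
  exact: ZD.
- move=> j v /= ->; have E u : Cmx (map_mx (mcoeff u) (0 : 'rV[R]_s)) *m D = 0.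
    by rewrite map_mx0 map_mx0 mul0mx.
  by split=> u.
- move=> j v _ [_ /= v0]; apply/rowP => a; rewrite mxE; apply/mpolyP => u; rewrite mcoeff0.
  by have /rowP/(_ a) := iD _ (v0 u); rewrite !mxE.
- move=> j f [f1 f2 f3].
  have /fun_choice[c Hc] : forall u, exists c : 'rV[K]_s,
      f u = Cmx c *m D /\ (mdeg u <> j -> c = 0).
    move=> u; have [du|/eqP du] := eqVneq (mdeg u) j.
      by have [c ->] := sD _ (f2 u); exists c.
    by exists 0; rewrite f1 // map_mx0 mul0mx.
  pose v : 'rV[R]_s := \sum_(u <- mons n j) 'X_[u] *: Cmx (c u).
  have hv a : v 0 a \is j.-homog.
    rewrite summxE big_seq; apply: rpred_sum => u; rewrite mem_mons => /eqP du.
    by rewrite !mxE mulrC mul_mpolyC; apply: rpredZ; rewrite dhomogX /= du.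
  have vE u : map_mx (mcoeff u) v = c u.
    apply/rowP => a; rewrite !mxE summxE raddf_sum /=.
    under eq_bigr do rewrite !mxE mulrC mul_mpolyC mcoeffZ mcoeffX.
    have [du|/eqP du] := eqVneq (mdeg u) j.
      rewrite (bigD1_seq u) ?uniq_mons ?mem_mons ?du //= eqxx mulr1 big1 ?addr0 // => w.
      by move/negbTE ->; rewrite mulr0.
    rewrite (proj2 (Hc u) du) mxE big1_seq // => w; rewrite mem_mons => /eqP dw.
    by case: eqP => [e1|]; rewrite ?mulr0 //; rewrite e1 in dw.
  have phiE : (fun u => Cmx (map_mx (mcoeff u) v) *m D) = f.
    by apply: functional_extensionality => u; rewrite vE (proj1 (Hc u)).
  exists v; last by rewrite phiE subrr; exact: (@gB0 _ (syz (vmod HS) e)).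
  by split=> //; rewrite -(gevE j v hv) phiE.
Qed.

Lemma gen_in_span r (S : 'rV[R]_r -> Prop) (HS : graded_sub S) e s (D : 'M[R]_(s, r)) :
  gen_in (vmod HS) e -> (forall j, S (row j D)) ->
  (forall v, gm_Z (vmod HS) e v -> exists c : 'rV[K]_s, v = Cmx c *m D) ->
  forall v, S v <-> exists w, v = w *m D.
Proof.
move=> [G1 G2] rD sD v; split=> [Sv|[w ->]]; last exact: gs_mulmx.
have H k (u : 'rV[R]_r) : gm_Z (vmod HS) k u -> exists w, u = w *m D.
  elim: k u => [|k IH] u Zu.
    case: (posnP e) => [e0|e0]; last by exists 0; rewrite mul0mx; exact: (G1 0%N).
    by rewrite -e0 in Zu; have [c ->] := sD _ Zu; exists (Cmx c).
  have [lt|lt|eq] := ltngtP k.+1 e.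
  - by exists 0; rewrite mul0mx; exact: (G1 k.+1).
  - have [w [Zw /= /eqP]] := G2 k u lt Zu; rewrite subr_eq0 => /eqP ->.
    have [y Hy] := fun_choice (fun i => IH _ (Zw i)).
    exists (\sum_i 'X_i *: y i); rewrite mulmx_suml; apply: eq_bigr => i _.
    by rewrite -scalemxAl -Hy.
  - by rewrite eq in Zu; have [c ->] := sD _ Zu; exists (Cmx c).
have [N ->] := vproj_sum_all v.
have /fun_choice[w Hw] : forall k : 'I_N, exists w, vproj deg0 (Posz k) v = w *m D.
  move=> k; apply: (H k); split; first exact: gs_proj.
  exact/vhomog_nat/vprojP.
by exists (\sum_k w k); rewrite mulmx_suml; apply: eq_bigr => k _.
Qed.

End GradedBasis.

(** * Linear resolutions *)

Section FromLin.
Variables (K : fieldType) (n : nat).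
Local Notation R := {mpoly K[n]}.
Local Notation Cmx := (map_mx (@mpolyC n K)).

Definition ideal_vec (J : R -> Prop) (v : 'rV[R]_1) := J (v 0 0).

Lemma ideal_vec_graded_sub J : homogeneous_ideal J -> graded_sub (ideal_vec J).
Proof.
move=> [HJ hJ]; split; rewrite /ideal_vec.
- by rewrite mxE; exact: ideal_zero.
- by move=> u v Ju Jv; rewrite mxE; exact: ideal_add.
- by move=> a u Ju; rewrite mxE; exact: ideal_mull.
- by move=> k u Ju; rewrite mxE subr0; exact: hJ.
Qed.

Lemma ideal_vec_iso J (HJ : is_ideal J) (HS : graded_sub (ideal_vec J)) :
  gm_iso (M := idmod HJ) (N := vmod HS) (fun f => const_mx f).
Proof.
split.
- by move=> u v; apply/rowP => a; rewrite !mxE.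
- by move=> i v; apply/rowP => a; rewrite !mxE.
- by move=> k v [Jv hv]; split; [rewrite /ideal_vec mxE|move=> a; rewrite mxE].
- by move=> k v /= ->; apply/rowP => a; rewrite !mxE.
- by move=> k v _ /= /rowP/(_ 0); rewrite !mxE.
- move=> k w [Jw hw]; exists (w 0 0); first by split.
  by apply/rowP => a; rewrite !mxE ord1 subrr.
Qed.

Lemma lin_step r (S : 'rV[R]_r -> Prop) (HS : graded_sub S) e : (forall t, lin t (vmod HS) e) ->
  exists s (D : 'M[R]_(s, r)), [/\ forall a b, D a b \is e.-homog,
    forall v, S v <-> exists w, v = w *m D &
    forall (Hk : graded_sub (fun v : 'rV[R]_s => v *m D = 0)) t, lin t (vmod Hk) 1].
Proof.
move=> L; have [s [D [rD iD sD]]] := graded_basis HS e.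
have [G _] := L 1%N.
exists s, D; split.
- by move=> a b; have [_ /(_ b)] := rD a; rewrite mxE.
- by apply: gen_in_span G _ sD => j; case: (rD j).
- move=> Hk t; apply/(lin_iso t 1 (syz_basis_iso Hk rD iD sD)).
  by case: (L t.+1).
Qed.

(** The state of the iterative construction of a resolution; the ranks are bundled because they
    change at each step. *)
Record lin_matrix := LinMatrix {
  lm_s : nat; lm_r : nat; lm_D : 'M[R]_(lm_s, lm_r);
  lm_lin : exists Hk : graded_sub (fun v : 'rV[R]_lm_s => v *m lm_D = 0),
    forall t, lin t (vmod Hk) 1 }.

Definition next_spec (M : lin_matrix) (p : {s : nat & 'M[R]_(s, lm_s M)}) : Prop :=
  [/\ forall a b, projT2 p a b \is 1.-homog,
    forall v : 'rV[R]_(lm_s M), v *m lm_D M = 0 <-> exists w, v = w *m projT2 p &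
    exists Hk : graded_sub (fun v : 'rV[R]_(projT1 p) => v *m projT2 p = 0),
      forall t, lin t (vmod Hk) 1].

Lemma next_exists M : exists p, next_spec (M := M) p.
Proof.
have [Hk L] := lm_lin M; have [s [D [hD eD LD]]] := lin_step L.
exists (existT _ s D); split=> //=.
by exists (ker_graded_sub hD); exact: LD.
Qed.

Definition next_matrix M := proj1_sig (constructive_indefinite_description _ (next_exists M)).
Lemma next_matrixP M : next_spec (next_matrix M).
Proof. exact: proj2_sig. Qed.

Definition next_lin M : lin_matrix :=
  LinMatrix (let: And3 _ _ h := next_matrixP M in h).

Definition lin_seq (M : lin_matrix) := fix loop i := if i is i'.+1 then next_lin (loop i') else M.

Lemma linear_resolution_of_lin (J : R -> Prop) (hJ : homogeneous_ideal J) d :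
  (forall t, lin t (idmod (proj1 hJ)) d) -> linear_resolution J d.
Proof.
move=> L; have HS := ideal_vec_graded_sub hJ.
have LS t : lin t (vmod HS) d by rewrite -(lin_iso t d (ideal_vec_iso (proj1 hJ) HS)).
have [s [D [hD eD LD]]] := lin_step LS.
pose M0 := LinMatrix (ex_intro _ (ker_graded_sub hD) (LD (ker_graded_sub hD))).
pose F := @FreeComplex K n (fun i => lm_s (lin_seq M0 i)) (fun i _ => (d + i)%N%:Z) D
  (fun i => projT2 (next_matrix (lin_seq M0 i))).
exists F.
  split.
  - by move=> a m /= ma; rewrite addn0; have /= -> := dhomog_mf (hD a 0) ma.
  - move=> i a b m /= ma; have [h _ _] := next_matrixP (lin_seq M0 i).
    by have /= -> := dhomog_mf (h a b) ma; rewrite -PoszD add1n addnS.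
  - move=> f; have := eD (const_mx f); rewrite /ideal_vec mxE => e; rewrite e /=.
    split=> -[w E]; exists w; first by rewrite -E mxE.
    by apply/rowP => a; rewrite ord1 mxE.
  - by move=> v; have [_ h _] := next_matrixP M0.
  - by move=> i v; have [_ h _] := next_matrixP (next_lin (lin_seq M0 i)).
(* All basis vectors of F_i have degree d + i, so nothing nonzero lives in degree i + j when j
   differs from d. *)
move=> i j jd v vd _; exists 0; first by move=> a; rewrite mxE eqxx.
rewrite mul0mx; apply/rowP => a; rewrite mxE; apply/eqP; apply: contra_notT jd => va.
by have := vd a va; rewrite /= PoszD addrC => /addrI ->.
Qed.

End FromLin.

Lemma mpoly_no_constant (K : fieldType) n (p : {mpoly K[n]}) : p@_0%MM = 0 ->
  exists q : 'I_n -> {mpoly K[n]}, p = \sum_i 'X_i * q i.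
Proof.
move=> p0; have H u : u != 0%MM -> exists q : 'I_n -> {mpoly K[n]}, 'X_[u] = \sum_i 'X_i * q i.
  elim/mnm_add1_ind: u => [/eqP //|u i _ _].
  exists (fun j => if j == i then 'X_[u] else 0); rewrite (bigD1 i) //= eqxx big1 ?addr0.
    by rewrite addmC mpolyXD.
  by move=> j /negbTE ->; rewrite mulr0.
have /fun_choice[q Hq] : forall u, exists q : 'I_n -> {mpoly K[n]},
    u \in msupp p -> 'X_[u] = \sum_i 'X_i * q i.
  move=> u; case: (eqVneq u 0%MM) => [->|/H[q e]]; last by exists q.
  by exists (fun _ => 0); rewrite mcoeff_msupp p0 eqxx.
exists (fun i => \sum_(u <- msupp p) p@_u *: q u i); rewrite {1}[p]mpolyE.
under [RHS]eq_bigr do rewrite mulr_sumr; rewrite exchange_big /=.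
apply: eq_big_seq => u up; rewrite {1}(Hq u up) scaler_sumr.
by apply: eq_bigr => i _; rewrite scalerAr.
Qed.

(** * Comparison of an arbitrary resolution with the linear strand *)

Section Comparison.
Variables (K : fieldType) (n : nat) (F : free_complex K n) (J : {mpoly K[n]} -> Prop) (d : nat).
Local Notation R := {mpoly K[n]}.
Local Notation Cmx := (map_mx (@mpolyC n K)).
Local Notation coef0 := (map_mx (mcoeff (0%MM : 'X_{1..n}))).
Hypothesis HF : is_free_resolution F J.
Hypothesis tor : forall (i : nat) (j : int), j <> d%:Z -> tor_vanishes F i (i%:Z + j).

Lemma diff_homog i : mx_homog (@fr_deg _ _ F i.+1) (@fr_deg _ _ F i) (fr_diff F i).
Proof. by move=> a b m /(fr_diff_homog HF) <-; rewrite addrK. Qed.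

Lemma aug_homog : mx_homog (@fr_deg _ _ F 0) deg0 (fr_aug F).
Proof. by move=> a b m; rewrite (ord1 b) => /(fr_aug_homog HF) ->; rewrite subr0. Qed.

Lemma diff_diff i : fr_diff F i.+1 *m fr_diff F i = 0.
Proof.
apply/row_matrixP => a; rewrite row_mul row0; apply/(fr_exactS HF).
by exists (delta_mx 0 a); rewrite rowE.
Qed.

Lemma diff_aug : fr_diff F 0 *m fr_aug F = 0.
Proof.
apply/row_matrixP => a; rewrite row_mul row0; apply/(fr_exact0 HF).
by exists (delta_mx 0 a); rewrite rowE.
Qed.

Lemma coef0_mul s r (v : 'rV[R]_s) (D : 'M[R]_(s, r)) : coef0 (v *m D) = coef0 v *m coef0 D.
Proof. exact: map_mxM. Qed.

Lemma no_constant_mulmx s r (S : 'rV[R]_r -> Prop) (HS : graded_sub S) (v : 'rV[R]_s)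
    (G : 'M[R]_(s, r)) : coef0 v = 0 -> (forall j, S (row j G)) ->
  exists2 w : 'I_n -> 'rV[R]_r, forall i, S (w i) & v *m G = \sum_i 'X_i *: w i.
Proof.
move=> v0 SG.
have /fun_choice[q Hq] : forall a, exists q : 'I_n -> R, v 0 a = \sum_i 'X_i * q i.
  by move=> a; apply: mpoly_no_constant; have /rowP/(_ a) := v0; rewrite !mxE.
exists (fun i => \sum_a q a i *: row a G).
  by move=> i; apply: gs_sum => // a _; exact: gs_scale.
rewrite mulmx_sum_row; under [RHS]eq_bigr do rewrite scaler_sumr.
rewrite exchange_big; apply: eq_bigr => a _; rewrite Hq scaler_suml.
by apply: eq_bigr => i _; rewrite scalerA.
Qed.

(* [alpha] and [beta] compare the linear strand with F, up to a homotopy E. *)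
Lemma lin_comparison t : forall i s (Y : 'rV[R]_s -> Prop) (HY : graded_sub Y)
    (alpha : 'M[R]_(s, fr_rank F i)) (beta : 'M[R]_(fr_rank F i, s)) (E : 'M[R]_s),
  (forall c : 'rV[K]_s, Y (Cmx c) -> c = 0) ->
  (forall j, vhomog (@fr_deg _ _ F i) (d + i)%N%:Z (row j alpha)) ->
  (forall z, Y z -> exists y, z *m alpha = y *m fr_diff F i) ->
  (forall y, Y (y *m fr_diff F i *m beta)) ->
  (forall j, Y (row j E)) ->
  (forall z, Y z -> z *m alpha *m beta = z + z *m E) ->
  lin t (vmod HY) 1.
Proof.
elim: t => // t IH i s Y HY alpha beta E indep hal Yal Ybe YE homot.
have halM : mx_homog (fun _ : 'I_s => (d + i)%N%:Z) (@fr_deg _ _ F i) alpha.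
  by move=> a b; have := hal a b; rewrite mxE.
pose gamma := fr_diff F i *m beta.
have Yga a : Y (row a gamma) by rewrite rowE mulmxA; exact: Ybe.
have G : gen_in (vmod HY) 1.
  split=> [k z|k z lk [Yz hz]].
    rewrite ltnS leqn0 => /eqP -> [Yz hz] /=.
    have def_z : z = Cmx (coef0 z).
      apply/rowP => a; rewrite !mxE; apply: msize1_polyC; rewrite msizeE.
      by apply/bigmax_leqP_seq => m mz _; rewrite ltnS; have /= -> := dhomog_mf (hz a) mz.
    by rewrite def_z (indep (coef0 z)) ?map_mx0 // -def_z.
  have z0 : coef0 z = 0.
    by apply/rowP => a; rewrite !mxE (dhomog_nemf_coeff (hz a)) //= mdeg0.
  (* [kk] is (i + 1) + (d + k) with k > 0, so Tor_(i+1) vanishes in this degree. *)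
  pose kk : int := (d + i)%N%:Z + k.+1%:Z.
  have hzal : vhomog (@fr_deg _ _ F i) kk (z *m alpha).
    apply: (vhomog_mul halM) => a; rewrite /kk addrC addKr.
    exact/ihomog_nat.
  have [y hy def_y] := vhomog_lift (diff_homog (i := i)) hzal (Yal z Yz).
  have [] := @tor i.+1 (kk - i.+1%:Z) _ (coef0 y).
  - by rewrite /kk; lia.
  - move=> a; rewrite mxE => ya; have := hy a 0%MM; rewrite mcoeff_msupp => /(_ ya).
    by rewrite mdeg0 => /esym/eqP; rewrite subr_eq0 => /eqP <-; rewrite addrC subrK.
  - by rewrite /fr_cycleK /fr_diffK -coef0_mul -def_y coef0_mul z0 mul0mx.
  move=> w _ def_w.
  (* Subtracting the boundary of the constant vector [w] removes the constant terms of [y] and does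
     not change its image. *)
  pose y' := y - Cmx w *m fr_diff F i.+1.
  have y'0 : coef0 y' = 0.
    rewrite /y' [coef0 _]raddfB /= coef0_mul map_CmxE eqxx def_w.
    by rewrite [X in _ - X](_ : _ = w *m fr_diffK F i.+1) ?subrr.
  (* By [homot], z + z E = y' gamma. Neither y' nor z has constant terms, and the rows of gamma and
     E are in Y, so z lies in mY. *)
  have def_z : z = y' *m gamma - z *m E.
    rewrite /gamma mulmxA /y' mulmxBl -mulmxA diff_diff mulmx0 subr0 -def_y homot //.
    by rewrite addrK.
  have [w1 Yw1 e1] := no_constant_mulmx HY y'0 Yga.
  have [w2 Yw2 e2] := no_constant_mulmx HY z0 YE.
  exists (fun l => vproj deg0 (Posz k) (w1 l - w2 l)); split=> [l|].
    split; first by apply: (gs_proj HY); exact: gs_sub.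
    exact/vhomog_nat/vprojP.
  apply/eqP; rewrite /= subr_eq0; apply/eqP.
  rewrite -{1}(@vproj_id _ _ _ deg0 (Posz k.+1) z); last exact/vhomog_nat.
  rewrite def_z e1 e2 -sumrB vproj_sum; apply: eq_bigr => l _.
  by rewrite -scalerBr -(addn1 k) PoszD vprojZX.
split=> //.
have [s' [D [rD iD sD]]] := graded_basis HY 1.
have hD a b : D a b \is 1.-homog by have [_ /(_ b)] := rD a; rewrite mxE.
have YD j : Y (row j D) by case: (rD j).
have span := gen_in_span G YD sD.
pose Hk := ker_graded_sub hD.
apply/(lin_iso t 1 (syz_basis_iso Hk rD iD sD)).
have lift_mx m (A : 'M[R]_(m, s)) : (forall j, Y (row j A)) -> exists B, A = B *m D.
  move=> YA; have /fun_choice[b Hb] : forall j, exists w, row j A = w *m D.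
    by move=> j; apply/span.
  by exists (\matrix_j b j); apply/row_matrixP => j; rewrite row_mul rowK.
have [beta' def_beta'] := lift_mx _ gamma Yga.
have [h def_h] := lift_mx _ E YE.
have /fun_choice[al Hal] : forall j, exists w,
    vhomog (@fr_deg _ _ F i.+1) (d + i.+1)%N%:Z w /\ row j D *m alpha = w *m fr_diff F i.
  move=> j; have hj : vhomog (@fr_deg _ _ F i) (d + i.+1)%N%:Z (row j D *m alpha).
    apply: (vhomog_mul halM) => a; rewrite addnS -addn1 PoszD [X in X - _]addrC addrK mxE.
    exact/ihomog_nat.
  by have [w] := vhomog_lift (diff_homog (i := i)) hj (Yal _ (YD j)); exists w.
pose alpha' : 'M[R]_(s', fr_rank F i.+1) := \matrix_j al j.
have def_alpha' : alpha' *m fr_diff F i = D *m alpha.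
  by apply/row_matrixP => j; rewrite !row_mul rowK; case: (Hal j).
have DDE : D *m alpha *m beta = D + D *m E.
  by apply/row_matrixP => j; rewrite !row_mul linearD /= row_mul homot.
(* The rows of [alpha' *m beta' - 1] need not lie in the kernel of [D]: multiplied by [D] they give
   D E = D h D. Subtracting [D *m h] corrects this and changes nothing on that kernel. *)
apply: (IH i.+1 s' _ Hk alpha' beta' (alpha' *m beta' - 1%:M - D *m h)).
- exact: iD.
- by move=> j; rewrite rowK; case: (Hal j).
- by move=> z zD; apply/(fr_exactS HF); rewrite -mulmxA def_alpha' mulmxA zD mul0mx.
- move=> y; rewrite -mulmxA -def_beta' /gamma !mulmxA -(mulmxA y) diff_diff mulmx0.
  by rewrite mul0mx.
- move=> j; rewrite -row_mul !mulmxBl mul1mx -!mulmxA -def_beta' -def_h.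
  rewrite /gamma mulmxA def_alpha' DDE -addrA -opprD subrr.
  exact: row0.
- move=> z zD; rewrite !mulmxBr mulmx1 [z *m (D *m h)]mulmxA zD mul0mx subr0.
  by rewrite -mulmxA addrC subrK.
Qed.

(** The comparison starts from two systems of generators of J, a basis of J_d and the augmentation
    of F, each expressed through the other. *)
Lemma lin_of_linear_resolution (hJ : homogeneous_ideal J) :
  gen_in (idmod (proj1 hJ)) d -> forall t, lin t (idmod (proj1 hJ)) d.
Proof.
move=> G t; have HS := ideal_vec_graded_sub hJ.
have iso := ideal_vec_iso (proj1 hJ) HS.
apply/(lin_iso t d iso); have GS : gen_in (vmod HS) d by apply/(iso_gen_in iso).
apply: linW; split=> //.
have [s [D [rD iD sD]]] := graded_basis HS d.
have hD a b : D a b \is d.-homog by have [_ /(_ b)] := rD a; rewrite mxE.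
have SD j : ideal_vec J (row j D) by case: (rD j).
have span := gen_in_span GS SD sD.
pose Hk := ker_graded_sub hD.
apply/(lin_iso t 1 (syz_basis_iso Hk rD iD sD)).
have Saug v : ideal_vec J v <-> exists w, v = w *m fr_aug F.
  rewrite /ideal_vec (fr_aug_image HF); split=> -[w e]; exists w; last by rewrite e.
  by apply/rowP => a; rewrite ord1 e.
have [beta def_beta] : exists beta, fr_aug F = beta *m D.
  have /fun_choice[b Hb] : forall j, exists w, row j (fr_aug F) = w *m D.
    by move=> j; apply/span/Saug; exists (delta_mx 0 j); rewrite rowE.
  by exists (\matrix_j b j); apply/row_matrixP => j; rewrite row_mul rowK.
have /fun_choice[al Hal] : forall j, exists w,
    vhomog (@fr_deg _ _ F 0) (d + 0)%N%:Z w /\ row j D = w *m fr_aug F.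
  move=> j; have hj : vhomog deg0 (d + 0)%N%:Z (row j D).
    by rewrite addn0; apply/vhomog_nat; case: (rD j).
  have /Saug ex := SD j.
  by have [w] := vhomog_lift aug_homog hj ex; exists w.
pose alpha : 'M[R]_(s, fr_rank F 0) := \matrix_j al j.
have def_alpha : alpha *m fr_aug F = D.
  by apply/row_matrixP => j; rewrite row_mul rowK; case: (Hal j).
apply: (@lin_comparison t 0 s _ Hk alpha beta (alpha *m beta - 1%:M)).
- exact: iD.
- by move=> j; rewrite rowK; case: (Hal j).
- by move=> z zD; apply/(fr_exact0 HF); rewrite -mulmxA def_alpha.
- by move=> y; rewrite -mulmxA -def_beta -mulmxA diff_aug mulmx0.
- by move=> j; rewrite -row_mul mulmxBl mul1mx -mulmxA -def_beta def_alpha subrr row0.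
- by move=> z zD; rewrite mulmxBr mulmx1 mulmxA addrC subrK.
Qed.

End Comparison.

(** * Graded components of ideals *)

Section Components.
Variable K : fieldType.

Lemma ideal_gen_ideal n (S : {mpoly K[n]} -> Prop) : is_ideal (ideal_gen S).
Proof.
split.
- by exists 0%N, (fun _ => 0), (fun _ => 0); split=> [[]//|]; rewrite big_ord0.
- move=> _ _ [r1 [a1 [s1 [S1 ->]]]] [r2 [a2 [s2 [S2 ->]]]].
  exists (r1 + r2)%N, (fun i => match split i with inl j => a1 j | inr j => a2 j end),
    (fun i => match split i with inl j => s1 j | inr j => s2 j end).
  split=> [i|]; first by case: (split i).
  rewrite big_split_ord /=; congr (_ + _); apply: eq_bigr => i _.
    by rewrite (unsplitK (inl i)).
  by rewrite (unsplitK (inr i)).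
- move=> b _ [r [a [s [Ss ->]]]]; exists r, (fun i => b * a i), s; split=> //.
  by rewrite mulr_sumr; apply: eq_bigr => i _; rewrite mulrA.
Qed.

Lemma ideal_gen_in n (S : {mpoly K[n]} -> Prop) f : S f -> ideal_gen S f.
Proof.
by move=> Sf; exists 1%N, (fun _ => 1), (fun _ => f); split=> //; rewrite big_ord1 mul1r.
Qed.

Lemma ideal_gen_min n (S J : {mpoly K[n]} -> Prop) f : is_ideal J -> (forall s, S s -> J s) ->
  ideal_gen S f -> J f.
Proof.
by move=> HJ SJ [r [a [s [Ss ->]]]]; apply: ideal_sum => // i _; apply: ideal_mull => //; exact: SJ.
Qed.

Section OneIdeal.
Variables (n d : nat) (I : {mpoly K[n]} -> Prop).
Local Notation C := (ideal_component I d).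

Lemma component_ideal : is_ideal C. Proof. exact: ideal_gen_ideal. Qed.

Lemma component_sub f : is_ideal I -> C f -> I f.
Proof. by move=> HI; apply: ideal_gen_min => // s []. Qed.

Lemma component_in f : I f -> f \is d.-homog -> C f.
Proof. by move=> If hf; apply: ideal_gen_in. Qed.

Lemma component_pihomog k f : C f -> exists r (a s : 'I_r -> {mpoly K[n]}),
  [/\ forall i, I (s i) /\ s i \is d.-homog, (k < d)%N -> pihomog mdeg k f = 0,
   (d <= k)%N -> (forall i, a i \is (k - d).-homog) &
   (d <= k)%N -> pihomog mdeg k f = \sum_i a i * s i].
Proof.
move=> [r [a [s [Ss ->]]]]; exists r, (fun i => pihomog mdeg (k - d) (a i)), s; split=> //.
- move=> kd; rewrite raddf_sum big1 // => i _ /=; apply: (@pihomogMr_low _ _ d) => //.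
  by case: (Ss i).
- by move=> _ i; exact: pihomogP.
- move=> dk; rewrite raddf_sum; apply: eq_bigr => i _ /=.
  by rewrite -{1}(subnK dk) pihomogMr //; case: (Ss i).
Qed.

Lemma component_homogeneous : homogeneous_ideal C.
Proof.
split; first exact: component_ideal.
move=> f k Cf; have [r [a [s [Ss lo _ hi]]]] := component_pihomog k Cf.
have [kd|dk] := ltnP k d; first by rewrite lo //; exact: (ideal_zero component_ideal).
by rewrite hi //; exists r, a, s.
Qed.

Lemma component_gen_in (HC : is_ideal C) : gen_in (idmod HC) d.
Proof.
split=> [k f kd [Cf hf] /=|k f dk [Cf hf]].
  have [r [a [s [_ lo _ _]]]] := component_pihomog k Cf.
  by rewrite -(pihomog_dE hf) lo.
have [r [a [s [Ss _ ha hi]]]] := component_pihomog k.+1 Cf.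
have {}ha := ha (leqW dk); have {}hi := hi (leqW dk).
have /fun_choice[q Hq] : forall i, exists q : 'I_n -> {mpoly K[n]}, a i = \sum_l 'X_l * q l.
  move=> i; apply: mpoly_no_constant; apply: (dhomog_nemf_coeff (ha i)).
  by rewrite /= mdeg0; lia.
exists (fun l => pihomog mdeg k (\sum_i q i l * s i)); split=> [l|/=].
  split; last exact: pihomogP.
  apply: (proj2 component_homogeneous); apply: (ideal_sum HC) => i _; apply: (ideal_mull HC).
  by case: (Ss i) => Is hs; exact: component_in.
apply/eqP; rewrite subr_eq0; apply/eqP; rewrite -{1}(pihomog_dE hf) hi.
rewrite -[LHS](@pihomog_dE _ _ mdeg k.+1); last by rewrite -hi pihomogP.
have -> : \sum_i a i * s i = \sum_i \sum_l 'X_l * q i l * s i.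
  by apply: eq_bigr => i _; rewrite Hq mulr_suml.
rewrite exchange_big raddf_sum; apply: eq_bigr => l _ /=.
have hX : ('X_l : {mpoly K[n]}) \is 1.-homog by rewrite dhomogX /= mdeg1.
rewrite [RHS]mulrC -(pihomogMr _ _ hX) addn1 mulr_suml; congr (pihomog _ _ _).
by apply: eq_bigr => i _; rewrite -mulrA mulrC.
Qed.

End OneIdeal.

(** I_<j> is generated in degree [j], so its forms of degree [k] are combinations of its forms of
    degree [d]. *)
Lemma component_raise n (I : {mpoly K[n]} -> Prop) j d k f : is_ideal I ->
  (j <= d <= k)%N -> f \is k.-homog -> ideal_component I j f -> ideal_component I d f.
Proof.
move=> HI /andP[jd dk] hf Cf; have [l def_k] : exists l, k = (d + l)%N by exists (k - d)%N; lia.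
subst k; elim: l f hf Cf {dk} => [|l IH] f; rewrite ?addn0 ?addnS => hf Cf.
  by apply: component_in => //; exact: component_sub Cf.
have HC := component_ideal j I; have [_ G] := component_gen_in HC.
have [||w [Zw /= /eqP]] := G (d + l)%N f; [by lia|by []|].
rewrite subr_eq0 => /eqP ->; apply: (ideal_sum (component_ideal d I)) => i _.
by apply: (ideal_mull (component_ideal d I)); have [Cw hw] := Zw i; exact: IH.
Qed.

Lemma component_image n m (A : 'M[K]_(n, m)) (B : 'M[K]_(m, n)) I d :
  B *m A = 1%:M -> homogeneous_ideal I ->
  same_ideal (ideal_component (ideal_image A I) d) (ideal_image A (ideal_component I d)).
Proof.
move=> BA [HI hI] f; split.
  apply: ideal_gen_min; first exact: ideal_image_ideal BA (component_ideal d I).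
  move=> _ [[h Ih ->] hh]; exists (pihomog mdeg d h).
    by apply: component_in; [exact: hI|exact: pihomogP].
  by rewrite -linear_subst_pihomog pihomog_dE.
move=> [_ [r [a [s [Ss ->]]]] ->]; rewrite linear_subst_sum.
apply: (ideal_sum (component_ideal d _)) => i _; rewrite linear_substM.
apply: (ideal_mull (component_ideal d _)); case: (Ss i) => Is hs; apply: component_in.
  by exists (s i).
exact: linear_subst_homog.
Qed.

Lemma linear_resolution_same n (J J' : {mpoly K[n]} -> Prop) d :
  same_ideal J J' -> linear_resolution J d -> linear_resolution J' d.
Proof.
move=> S [F [F1 F2 F3 F4 F5] T]; exists F => //; split=> // f.
by rewrite -(S f); exact: F3.
Qed.

(** * Transport along an invertible linear substitution *)

Section Transport.
Variables (n : nat) (g : 'M[K]_n).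
Hypothesis Ug : g \in unitmx.
Local Notation R := {mpoly K[n]}.
Let sg : R -> R := linear_subst g.
Let tg : R -> R := linear_subst (invmx g).

Lemma map_substK s r (D : 'M[R]_(s, r)) : map_mx sg (map_mx tg D) = D.
Proof. by apply/matrixP => a b; rewrite !mxE /sg /tg linear_substVK. Qed.

Lemma map_substVK s r (D : 'M[R]_(s, r)) : map_mx tg (map_mx sg D) = D.
Proof. by apply/matrixP => a b; rewrite !mxE /sg /tg linear_substK. Qed.

Lemma map_substM (h : 'M[K]_n) s r p (D : 'M[R]_(s, r)) (E : 'M[R]_(r, p)) :
  map_mx (linear_subst h) (D *m E) = map_mx (linear_subst h) D *m map_mx (linear_subst h) E.
Proof.
apply/matrixP => a b; rewrite !mxE linear_subst_sum; apply: eq_bigr => c _.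
by rewrite linear_substM !mxE.
Qed.

Lemma exact_transport s r p (D : 'M[R]_(s, r)) (E : 'M[R]_(p, s)) :
  (forall v : 'rV[R]_s, v *m D = 0 <-> exists w, v = w *m E) ->
  forall v : 'rV[R]_s, v *m map_mx sg D = 0 <-> exists w, v = w *m map_mx sg E.
Proof.
have m0 (h : 'M[K]_n) a b : map_mx (linear_subst h : R -> R) (0 : 'M[R]_(a, b)) = 0.
  by apply/matrixP => i j; rewrite !mxE linear_subst0.
move=> ex v; split=> [vD|[w ->]].
  have /ex[w def_w] : map_mx tg v *m D = 0.
    by rewrite -(map_substVK D) /tg -map_substM vD m0.
  by exists (map_mx sg w); rewrite /sg -map_substM -def_w map_substK.
rewrite -(map_substK w) /sg -!map_substM; have -> : map_mx tg w *m E *m D = 0.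
  by apply/ex; exists (map_mx tg w).
exact: m0.
Qed.

Lemma linear_resolution_image J d : linear_resolution J d ->
  linear_resolution (ideal_image g J) d.
Proof.
move=> [F [F1 F2 F3 F4 F5] T].
pose F' := @FreeComplex K n (fr_rank F) (@fr_deg _ _ F) (map_mx sg (fr_aug F))
  (fun i => map_mx sg (fr_diff F i)).
exists F'.
  split.
  - by move=> a m; rewrite /= mxE => /linear_subst_msupp[w ww <-]; exact: F1.
  - by move=> i a b m; rewrite /= mxE => /linear_subst_msupp[w ww <-]; exact: F2 ww.
  - move=> f; split=> [[h /F3[v ->] ->]|[v ->]].
      by exists (map_mx sg v); rewrite /= /sg -map_substM [RHS]mxE.
    exists ((map_mx tg v *m fr_aug F) 0 0); first by apply/F3; exists (map_mx tg v).
    by rewrite /= -{1}(map_substK v) /sg -map_substM [LHS]mxE.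
  - exact: exact_transport F4.
  - by move=> i; exact: exact_transport (F5 i).
(* Linear substitutions preserve constant terms, so F tensor K is literally the same complex. *)
have dK i : fr_diffK F' i = fr_diffK F i.
  by apply/matrixP => a b; rewrite !mxE /sg linear_subst_coef0.
move=> i j jd v vd vc; have [||w wd def_v] := T i j jd v.
- exact: vd.
- by case: i v vd vc {T} => //= i v vd; rewrite -dK.
- by exists w => //; rewrite dK.
Qed.

Lemma ideal_imageK (J : R -> Prop) : same_ideal (ideal_image (invmx g) (ideal_image g J)) J.
Proof.
move=> f; split=> [[_ [h Jh ->] ->]|Jf]; first by rewrite linear_substK.
by exists (linear_subst g f); [exists f|rewrite linear_substK].
Qed.

Lemma ideal_image_mem (J : R -> Prop) f : ideal_image g J (linear_subst g f) <-> J f.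
Proof.
by split=> [[h Jh /(can_inj (linear_substK Ug)) ->]//|Jf]; exists f.
Qed.

End Transport.

End Components.

(** * Noetherianity *)

Lemma nat_argmin (A : Type) (h : A -> nat) (P : A -> Prop) : (exists a, P a) ->
  exists2 a, P a & forall b, P b -> (h a <= h b)%N.
Proof.
move=> [a Pa]; elim: {a}(h a).+1 {-2}a (leqnn (h a).+1) Pa => // k IH a ak Pa.
case: (classic (exists2 b, P b & (h b < h a)%N)) => [[b Pb ba]|no].
  by apply: (IH b) => //; lia.
by exists a => // b Pb; rewrite leqNgt; apply/negP => ba; apply: no; exists b.
Qed.

Definition incr_seq (phi : nat -> nat) := forall i j, (i < j)%N -> (phi i < phi j)%N.

Lemma incr_seqP (phi : nat -> nat) : (forall i, (phi i < phi i.+1)%N) -> incr_seq phi.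
Proof.
move=> h i; elim=> // j IH; rewrite ltnS leq_eqVlt => /orP[/eqP -> //|/IH ij].
exact: ltn_trans ij (h j).
Qed.

Lemma nondecreasing_subseq (h : nat -> nat) :
  exists2 phi, incr_seq phi & forall i j, (i <= j)%N -> (h (phi i) <= h (phi j))%N.
Proof.
have /fun_choice[mu Hmu] : forall N, exists m, (N <= m)%N /\ forall m', (N <= m')%N -> (h m <= h m')%N.
  move=> N; have [|m Nm Hm] := @nat_argmin _ h (fun m => N <= m)%N; first by exists N.
  by exists m.
pose phi := fix loop i := if i is i'.+1 then mu (loop i').+1 else mu 0%N.
exists phi.
  by apply: incr_seqP => i /=; case: (Hmu (phi i).+1).
have step i : (h (phi i) <= h (phi i.+1))%N.
  case: i => [|i]; first by case: (Hmu 0%N) => _; apply.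
  have [_ h1] := Hmu (phi i).+1; apply: h1.
  have [l1 _] := Hmu (phi i).+1; have [l2 _] := Hmu (phi i.+1).+1.
  exact: leq_trans l1 (ltnW l2).
move=> i; elim=> [|j IH]; first by rewrite leqn0 => /eqP ->.
by rewrite leq_eqVlt => /orP[/eqP -> //|/IH ij]; exact: leq_trans ij (step j).
Qed.

(** A sequence of naturals has a nondecreasing subsequence; one is extracted for each coordinate in
    turn. *)
Lemma dickson n (u : nat -> 'X_{1..n}) : exists i j, (i < j)%N /\ (u i <= u j)%MM.
Proof.
suff /(_ n)[phi ip Hp] : forall k, exists2 phi, incr_seq phi &
    forall l : 'I_n, (l < k)%N -> forall i j, (i <= j)%N -> (u (phi i) l <= u (phi j) l)%N.
  exists (phi 0%N), (phi 1%N); split; first exact: ip.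
  by apply/mnm_lepP => l; apply: Hp.
elim=> [|k [phi ip Hp]]; first by exists id.
have [kn|nk] := ltnP k n; last by exists phi => // l _; apply: Hp; exact: leq_trans (ltn_ord l) nk.
have [psi is1 Hs] := nondecreasing_subseq (fun i => u (phi i) (Ordinal kn)).
exists (phi \o psi) => [i j ij|l lk i j ij] /=; first by apply/ip/is1.
move: lk; rewrite ltnS leq_eqVlt => /orP[/eqP lk|lk].
  by rewrite (_ : l = Ordinal kn); [exact: Hs|exact: val_inj].
apply: Hp => //; move: ij; rewrite leq_eqVlt => /orP[/eqP -> //|/is1/ltnW //].
Qed.

Section Noetherian.
Variables (K : fieldType) (n : nat).
Local Notation R := {mpoly K[n]}.

Lemma reduce_lead (f g : R) : f != 0 -> g != 0 -> (mlead g <= mlead f)%MM ->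
  exists a, f - a * g = 0 \/ (mlead (f - a * g) < mlead f)%O.
Proof.
move=> f0 g0 le; pose w := (mlead f - mlead g)%MM.
pose a : R := (mleadc f / mleadc g) *: 'X_[w]; exists a.
have gc0 : mleadc g != 0 by rewrite mleadc_eq0.
have la : mlead (a * g) = mlead f.
  have c0 : mleadc f / mleadc g != 0 by rewrite mulf_neq0 ?invr_eq0 ?mleadc_eq0.
  by rewrite /a -scalerAl mleadZ // mleadM ?mleadXm ?submK // -msize_poly_eq0 msizeX.
have [|ne] := eqVneq (f - a * g) 0; [by left|right].
rewrite lt_neqAle; apply/andP; split; last first.
  by apply: le_trans (mleadB_le _ _) _; rewrite la joinxx.
apply: contra ne => /eqP e; rewrite -mleadc_eq0 e mcoeffB -{2}la.
rewrite mleadcM_proper; last by rewrite /a mleadcZE mleadXm mcoeffX eqxx mulr1 -mulrA mulVf ?mulr1 ?mleadc_eq0.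
by rewrite /a mleadcZE mleadXm mcoeffX eqxx mulr1 -mulrA mulVf // mulr1 subrr.
Qed.

(** If the chain kept growing, choose for each stage m an element of the union outside [A m] with
    least leading monomial. By Dickson's lemma one of these monomials divides a later one, and a
    division step yields a smaller element outside the later stage. *)
Lemma ideal_chain_stable (A : nat -> R -> Prop) : (forall k, is_ideal (A k)) ->
  (forall k f, A k f -> A k.+1 f) -> exists m, forall k f, A k f -> A m f.
Proof.
move=> HA mono; apply: NNPP => no.
have monol k l f : (k <= l)%N -> A k f -> A l f.
  elim: l => [|l IH]; first by rewrite leqn0 => /eqP ->.
  by rewrite leq_eqVlt => /orP[/eqP -> //|/IH h /h /mono].
have ex m : exists f, (exists k, A k f) /\ ~ A m f.
  apply: NNPP => no'; apply: no; exists m => k f Af; apply: NNPP => nA.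
  by apply: no'; exists f; split=> //; exists k.
have /fun_choice[F HF] : forall m, exists p : R * nat, [/\ A p.2 p.1, ~ A m p.1, (m <= p.2)%N &
    forall f, (exists k, A k f) -> ~ A m f -> ~ (mlead f < mlead p.1)%O].
  move=> m; have [f Uf] := ex m; move: Uf.
  elim/(well_founded_ind (@ltom_wf n)): {f}(mlead f) {-2}f (erefl (mlead f)) => u IH f def_u [[k Akf] nA].
  case: (classic (exists g, ((exists k, A k g) /\ ~ A m g) /\ (mlead g < mlead f)%O)).
    by move=> [g [Ug lt]]; apply: (IH (mlead g)) (erefl _) Ug; rewrite -def_u.
  move=> nog; exists (f, maxn k m); split=> //=.
  - by apply: monol Akf; exact: leq_maxl.
  - exact: leq_maxr.
  - by move=> g Ug nAg lt; apply: nog; exists g.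
(* The next stage is one that already contains the element chosen for the current stage. *)
pose M := fix loop i := if i is i'.+1 then (F (loop i')).2 else 0%N.
have Mmono i j : (i <= j)%N -> (M i <= M j)%N.
  elim: j => [|j IH]; first by rewrite leqn0 => /eqP ->.
  rewrite leq_eqVlt => /orP[/eqP -> //|/IH h]; apply: leq_trans h _ => /=.
  by case: (HF (M j)).
have [i [j [ij le]]] := dickson (fun i => mlead (F (M i)).1).
have [Ai nAi _ _] := HF (M i); have [Aj nAj _ minj] := HF (M j).
have nz m : (F m).1 != 0.
  by have [_ nA _ _] := HF m; apply/eqP => e; apply: nA; rewrite e; exact: (ideal_zero (HA m)).
have [a Ha] := reduce_lead (nz (M j)) (nz (M i)) le.
have AiMj : A (M j) (a * (F (M i)).1).
  by apply: (ideal_mull (HA _)); apply: monol (Mmono i.+1 j ij) Ai.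
have nd : ~ A (M j) ((F (M j)).1 - a * (F (M i)).1).
  by move=> h; apply: nAj; rewrite -(subrK (a * (F (M i)).1) (F (M j)).1); exact: (ideal_add (HA _)).
case: Ha => [e|lt]; first by apply: nd; rewrite e; exact: (ideal_zero (HA _)).
apply: (minj _ _ nd lt); have [_ _ le2 _] := HF (M j); exists (F (M j)).2.
by apply: (ideal_sub (HA _)) => //; exact: monol AiMj.
Qed.

Lemma noetherian_ind (P : (R -> Prop) -> Prop) :
  (forall J, homogeneous_ideal J ->
     (forall J', homogeneous_ideal J' -> (forall f, J f -> J' f) -> (exists2 f, J' f & ~ J f) -> P J') ->
     P J) ->
  forall J, homogeneous_ideal J -> P J.
Proof.
move=> step J0 hJ0; apply: NNPP => nP0.
pose T := {J : R -> Prop | homogeneous_ideal J /\ ~ P J}.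
have /fun_choice[nx Hnx] : forall J : T, exists J' : T,
    (forall f, proj1_sig J f -> proj1_sig J' f) /\ exists2 f, proj1_sig J' f & ~ proj1_sig J f.
  move=> [J [hJ nPJ]]; apply: NNPP => no; apply: (nPJ); apply: step => // J' hJ' sub str.
  by apply: NNPP => nPJ'; apply: no; exists (exist _ J' (conj hJ' nPJ')).
pose A i := proj1_sig (iter i nx (exist _ J0 (conj hJ0 nP0) : T)).
have [m Hm] : exists m, forall k f, A k f -> A m f.
  apply: ideal_chain_stable => [k|k f].
    by rewrite /A; case: (iter _ _ _) => J [[]].
  by have [h _] := Hnx (iter k nx (exist _ J0 (conj hJ0 nP0) : T)); exact: h.
have [_ [f Af nAf]] := Hnx (iter m nx (exist _ J0 (conj hJ0 nP0) : T)).
by apply: nAf; apply: (Hm m.+1 f).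
Qed.

(** The ideals generated by the forms of I of degree at most m form a chain; [d0] is where it
    becomes stationary. *)
Lemma ideal_degree_stable (I : R -> Prop) : homogeneous_ideal I ->
  exists d0, forall d f, (d0 <= d)%N -> I f -> f \is d.-homog -> ideal_component I d0 f.
Proof.
move=> [HI hI]; pose A m := ideal_gen (fun f => I f /\ exists2 j, (j <= m)%N & f \is j.-homog).
have [||d0 Hd0] := @ideal_chain_stable A.
- by move=> k; exact: ideal_gen_ideal.
- move=> k f; apply: ideal_gen_min; first exact: ideal_gen_ideal.
  by move=> s [Is [j jk hj]]; apply: ideal_gen_in; split=> //; exists j => //; exact: leqW.
exists d0 => d f dd If hf.
have /Hd0[r [a [s [Ss def_f]]]] : A d f by apply: ideal_gen_in; split=> //; exists d.
rewrite -(pihomog_dE hf) def_f raddf_sum.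
apply: (ideal_sum (component_ideal d0 I)) => i _ /=; have [Is [j jd hj]] := Ss i.
apply: (@component_raise _ _ _ j d0 d) => //; [by rewrite jd dd|exact: pihomogP|].
apply: (proj2 (component_homogeneous j I)); apply: (ideal_mull (component_ideal j I)).
exact: component_in.
Qed.

(** * General linear forms *)

(** Equivalently, for homogeneous [J], (J : x)/J has finite length. *)
Definition eventually_regular (J : R -> Prop) (c : 'rV[K]_n) := exists e, forall k f,
  (e <= k)%N -> f \is k.-homog -> J (linear_form c * f) -> J f.

Definition add_principal (J : R -> Prop) f h := exists j q, J j /\ h = j + q * f.
Definition colon_by (J : R -> Prop) f h := J (h * f).

Lemma add_principal_homogeneous J f m : homogeneous_ideal J -> f \is m.-homog ->
  homogeneous_ideal (add_principal J f).
Proof.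
move=> [HJ hJ] hf; split; first split.
- by exists 0, 0; rewrite mul0r addr0; split=> //; exact: ideal_zero.
- move=> _ _ [j1 [q1 [J1 ->]]] [j2 [q2 [J2 ->]]]; exists (j1 + j2), (q1 + q2).
  by rewrite mulrDl addrACA; split=> //; exact: ideal_add.
- move=> b _ [j [q [Jj ->]]]; exists (b * j), (b * q).
  by rewrite mulrDr mulrA; split=> //; exact: ideal_mull.
move=> _ k [j [q [Jj ->]]]; rewrite pihomogD; exists (pihomog mdeg k j).
exists (if (m <= k)%N then pihomog mdeg (k - m) q else 0); split; first exact: hJ.
congr (_ + _); case: leqP => mk; first by rewrite -(pihomogMr _ _ hf) subnK.
by rewrite mul0r (pihomogMr_low _ hf).
Qed.

Lemma colon_by_homogeneous J f m : homogeneous_ideal J -> f \is m.-homog ->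
  homogeneous_ideal (colon_by J f).
Proof.
move=> [HJ hJ] hf; split; first split; rewrite /colon_by.
- by rewrite mul0r; exact: ideal_zero.
- by move=> g h Jg Jh; rewrite mulrDl; exact: ideal_add.
- by move=> b h Jh; rewrite -mulrA; exact: ideal_mull.
by move=> h k Jh; rewrite -(pihomogMr _ _ hf); exact: hJ.
Qed.

(** The coefficient rows of linear forms in J form a proper subspace; [p] is a linear functional
    vanishing on it, read off a column of [cokermx]. *)
Lemma linear_form_avoids (J : R -> Prop) i : is_ideal J -> ~ J 'X_i ->
  exists2 p : R, p != 0 & forall c : 'rV[K]_n, p.@[fun l => c 0 l] != 0 -> ~ J (linear_form c).
Proof.
move=> HJ nJ; have lfD (a : K) (u v : 'rV[K]_n) :
    linear_form (a *: u + v) = a *: linear_form u + linear_form v.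
  rewrite /linear_form scaler_sumr -big_split; apply: eq_bigr => l _ /=.
  by rewrite !mxE scalerDl scalerA.
have [|s [D [fD rD sD]]] := @subspace_basis K n (fun c => J (linear_form c)).
  by move=> u v a Ju Jv; rewrite lfD; apply: ideal_add => //; exact: ideal_scale.
have : ~~ ((delta_mx 0 i : 'rV[K]_n) <= D)%MS.
  apply/negP => /submxP[c def_c]; apply: nJ; rewrite -linear_form_delta def_c.
  rewrite mulmx_sum_row; elim/big_ind: _ => [|u v Ju Jv|j _].
  - by rewrite linear_form0; exact: ideal_zero.
  - by rewrite -(scale1r u) lfD scale1r; exact: ideal_add.
  - by rewrite -[_ *: _]addr0 lfD linear_form0 addr0; exact: ideal_scale.
rewrite submxE => /rV0Pn[j Hj].
pose p : R := linear_form (col j (cokermx D))^T.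
have pE (c : 'rV[K]_n) : p.@[fun l => c 0 l] = (c *m cokermx D) 0 j.
  rewrite /p /linear_form raddf_sum mxE; apply: eq_bigr => l _ /=.
  by rewrite mevalZ mevalXU !mxE mulrC.
exists p; first by apply: contraNneq Hj => p0; rewrite -pE p0 meval0.
move=> c; rewrite pE => pc Jc; have := sD c Jc; rewrite submxE => /eqP c0.
by move: pc; rewrite c0 mxE eqxx.
Qed.

(** If f g is in J for forms f and g outside J, then J + (f) and J : f are strictly larger, and the
    claim for both gives it for J, because R/J is an extension of R/(J + (f)) by R/(J : f).
    Otherwise every form outside J is regular modulo J; if no variable is outside, J contains all
    forms of positive degree. *)
Lemma general_form_regular (J : R -> Prop) : homogeneous_ideal J ->
  exists2 p : R, p != 0 & forall c : 'rV[K]_n, p.@[fun l => c 0 l] != 0 -> eventually_regular J c.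
Proof.
move: J; apply: noetherian_ind => J hJ IH; have [HJ homJ] := hJ.
case: (classic (exists f g m b, [/\ f \is m.-homog, g \is b.-homog, ~ J f, ~ J g & J (f * g)])).
  move=> [f [g [m [b [hf hg nf ng Jfg]]]]].
  have [||p1 p10 H1] := IH _ (add_principal_homogeneous hJ hf).
  - by move=> h Jh; exists h, 0; rewrite mul0r addr0.
  - by exists f => //; exists 0, 1; rewrite mul1r add0r; split=> //; exact: ideal_zero.
  have [||p2 p20 H2] := IH _ (colon_by_homogeneous hJ hf).
  - by move=> h Jh; rewrite /colon_by mulrC; exact: ideal_mull.
  - by exists g => //; rewrite /colon_by mulrC.
  exists (p1 * p2); first by rewrite mulf_neq0.
  move=> c; rewrite mevalM mulf_eq0 negb_or => /andP[/H1[e1 E1] /H2[e2 E2]].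
  exists (maxn e1 (e2 + m)) => k h; rewrite geq_max => /andP[k1 k2] hh Jxh.
  have [|j [q [Jj def_h]]] := E1 k h k1 hh.
    by exists (linear_form c * h), 0; rewrite mul0r addr0.
  have mk : (m <= k)%N by lia.
  pose q' := pihomog mdeg (k - m) q; pose j' := pihomog mdeg k j.
  have Jj' : J j' by exact: homJ.
  have def_h' : h = j' + q' * f.
    rewrite -(pihomog_dE hh) def_h pihomogD; congr (_ + _).
    by rewrite -{1}(subnK mk) pihomogMr.
  rewrite def_h'; apply: ideal_add => //; apply: (E2 (k - m)%N q'); [by lia|exact: pihomogP|].
  rewrite /colon_by -mulrA.
  have -> : q' * f = h - j' by rewrite def_h' addrC addKr.
  by rewrite mulrBr; apply: ideal_sub => //; exact: ideal_mull.
move=> prime; case: (classic (exists i, ~ J 'X_i)) => [[i nJ]|allJ].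
  have [p p0 Hp] := linear_form_avoids HJ nJ; exists p => // c /Hp nc.
  exists 0%N => k f _ hf Jf; apply: NNPP => nf; apply: prime.
  by exists (linear_form c), f, 1%N, k; split=> //; exact: linear_form_homog.
exists 1; first exact: oner_neq0.
move=> c _; exists 1%N => k f k1 hf _.
have [|q ->] := @mpoly_no_constant _ _ f.
  by apply: (dhomog_nemf_coeff hf); rewrite /= mdeg0; lia.
apply: ideal_sum => // i _; rewrite mulrC; apply: ideal_mull => //.
by apply: NNPP => nJ; apply: allJ; exists i.
Qed.

Lemma expansion_inj (N : nat) (u w : 'X_{1..n}) : (forall i, (u i < N)%N) -> (forall i, (w i < N)%N) ->
  (\sum_(i < n) u i * N ^ i = \sum_(i < n) w i * N ^ i)%N -> u = w.
Proof.
move=> hu hw e; apply/mnmP.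
have H m (f g : 'I_m -> nat) : (forall i, (f i < N)%N) -> (forall i, (g i < N)%N) ->
    (\sum_(i < m) f i * N ^ i = \sum_(i < m) g i * N ^ i)%N -> f =1 g.
  elim: m f g => [|m IHm] f g hf hg; first by move=> _ [].
  rewrite !big_ord_recl !expn0 !muln1 => e1.
  have N0 : (0 < N)%N by exact: leq_ltn_trans (hf ord0).
  have sE (h : 'I_m.+1 -> nat) : (\sum_(i < m) h (lift ord0 i) * N ^ lift ord0 i =
      (\sum_(i < m) h (lift ord0 i) * N ^ i) * N)%N.
    by rewrite big_distrl; apply: eq_bigr => i _ /=; rewrite /bump add1n expnSr mulnA.
  rewrite !sE in e1.
  have e2 : f ord0 = g ord0.
    by have := congr1 (fun x => x %% N)%N e1; rewrite /= addnC modnMDl addnC modnMDl !modn_small.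
  have e3 : (fun i : 'I_m => f (lift ord0 i)) =1 (fun i => g (lift ord0 i)).
    apply: IHm => [i|i|]; [exact: hf|exact: hg|].
    by move: e1; rewrite e2 => /addnI/eqP; rewrite eqn_pmul2r // => /eqP.
  by move=> i; case: (unliftP ord0 i) => [j ->|->] //; exact: e3.
exact: H e.
Qed.

(** Kronecker substitution: x_i goes to x^(N^i) with N above all exponents. Distinct monomials of
    [p] become distinct powers, which leaves a nonzero polynomial in one variable. *)
Lemma mpoly_nonvanishing (p : R) : infinite_field K -> p != 0 -> exists v : 'I_n -> K, p.@[v] != 0.
Proof.
move=> infK p0.
have big_uniq k : exists2 s : seq K, uniq s & size s = k.
  elim: k => [|k [s us ss]]; first by exists [::].
  by have [x xs] := infK s; exists (x :: s); rewrite /= ?xs ?us ?ss.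
pose N := msize p; pose wt (u : 'X_{1..n}) := (\sum_(i < n) u i * N ^ i)%N.
have bnd u i : u \in msupp p -> (u i < N)%N.
  move=> /msize_mdeg_lt; apply: leq_ltn_trans; rewrite mdegE (bigD1 i) //=; exact: leq_addr.
pose q : {poly K} := \sum_(u <- msupp p) p@_u *: 'X^(wt u).
have q0 : q != 0.
  have lp := mlead_supp p0; apply: contraTneq lp => q0.
  rewrite mcoeff_msupp negbK; have := congr1 (fun h : {poly K} => h`_(wt (mlead p))) q0.
  rewrite coef0 /q coef_sum (bigD1_seq (mlead p)) ?msupp_uniq ?mlead_supp //=.
  rewrite coefZ coefXn eqxx mulr1 big1_seq ?addr0 => [-> //|u /andP[ul up]].
  rewrite coefZ coefXn; case: eqP => [e|]; last by rewrite mulr0.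
  by case/eqP: ul; apply: (@expansion_inj N) => // i; apply: bnd => //; exact: mlead_supp.
have [s us ss] := big_uniq (size q).
have [x xs qx] : exists2 x, x \in s & ~~ root q x.
  apply/allPn; apply/negP => all_r; have := max_poly_roots q0 all_r us.
  by rewrite ss ltnn.
exists (fun i => x ^+ (N ^ i)); apply: contra qx => /eqP px; rewrite /root -px.
rewrite /q horner_sum mevalE; apply/eqP; apply: eq_bigr => u _.
rewrite hornerZ hornerXn /wt; congr (_ * _); rewrite -prodrXr; apply: eq_bigr => i _.
by rewrite -exprM mulnC.
Qed.

End Noetherian.

(** * Hyperplane sections of componentwise linear ideals *)

Section Main.
Variable K : fieldType.

Lemma max_ideal_no_constant n (f : {mpoly K[n]}) : f@_0%MM = 0 -> max_ideal f.
Proof.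
case/mpoly_no_constant => q ->; exists n, q, (fun i => 'X_i); split=> [i|]; first by exists i.
by apply: eq_bigr => i _; rewrite mulrC.
Qed.

Lemma no_constant_max_ideal n (f : {mpoly K[n]}) : max_ideal f -> f@_0%MM = 0.
Proof.
move=> [r [a [s [Ss ->]]]]; rewrite raddf_sum big1 // => i _ /=.
have [l ->] := Ss i; rewrite [(_ * _)@_0]rmorphM /= mcoeffX mnm1_eq0.
exact: mulr0.
Qed.

Lemma component_succ_in_product n (I : {mpoly K[n]} -> Prop) d f :
  f \is d.+1.-homog -> ideal_component I d f -> ideal_mul (@max_ideal K n) I f.
Proof.
move=> hf /(component_pihomog d.+1)[r [a [s [Ss _ ha hi]]]].
exists r, (fun _ => 1), (fun i => a i * s i); split=> [i|].
  exists (a i), (s i); split=> //; last by case: (Ss i).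
  apply: max_ideal_no_constant; apply: (dhomog_nemf_coeff (ha _ i)) => //=.
  by rewrite mdeg0; lia.
by rewrite -(pihomog_dE hf) hi //; apply: eq_bigr => i _; rewrite mul1r.
Qed.

Lemma product_in_component_succ n (I : {mpoly K[n]} -> Prop) d f : homogeneous_ideal I ->
  ideal_mul (@max_ideal K n) I f -> ideal_component I d (pihomog mdeg d.+1 f).
Proof.
move=> [HI hI] [r [a [s [Ss ->]]]]; rewrite raddf_sum.
have HC := component_ideal d I; apply: (ideal_sum HC) => i _ /=.
have [b [h [/no_constant_max_ideal b0 Ih ->]]] := Ss i.
have [q ->] := mpoly_no_constant b0; rewrite mulr_suml mulr_sumr raddf_sum.
apply: (ideal_sum HC) => l _ /=.
have hX : ('X_l : {mpoly K[n]}) \is 1.-homog by rewrite dhomogX /= mdeg1.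
have -> : a i * ('X_l * q l * h) = (a i * q l * h) * 'X_l by ring.
rewrite -addn1 (pihomogMr _ _ hX) mulrC; apply: (ideal_mull HC).
by apply: component_in; [apply: hI; exact: ideal_mull|exact: pihomogP].
Qed.

Lemma lin_component n (I : {mpoly K[n]} -> Prop) d :
  linear_resolution (ideal_component I d) d ->
  forall t, lin t (idmod (proj1 (component_homogeneous d I))) d.
Proof. by move=> [F HF tor]; apply: (lin_of_linear_resolution HF tor); exact: component_gen_in. Qed.

(** * Coordinates in which the linear form is a multiple of x_0 *)

Section Coordinates.
Variables (n : nat) (g : 'M[K]_n.+1) (c : 'rV[K]_n.+1) (lam : K).
Hypotheses (Ug : g \in unitmx) (lam0 : lam != 0).
Hypothesis cg : linear_subst g (linear_form c) = lam *: 'X_ord0.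

Lemma colon_transport (J : {mpoly K[n.+1]} -> Prop) f : is_ideal J ->
  ideal_image g J ('X_ord0 * linear_subst g f) <-> J (linear_form c * f).
Proof.
move=> HJ; rewrite -(ideal_image_mem Ug J) linear_substM cg -scalerAl.
have HgJ := ideal_image_ideal (mulVmx Ug) HJ; split; first exact: ideal_scale.
by move/(ideal_scale HgJ lam^-1); rewrite scalerA mulVf // scale1r.
Qed.

Lemma kill_image (J : {mpoly K[n.+1]} -> Prop) :
  same_ideal (ideal_image (g *m kill0 K n) J) (ideal_image (kill0 K n) (ideal_image g J)).
Proof.
move=> f; split=> [[h Jh ->]|[_ [h Jh ->] ->]].
  by exists (linear_subst g h); [exists h|rewrite linear_subst_comp].
by exists h => //; rewrite linear_subst_comp.
Qed.

Lemma section_inv : incl0 K n *m invmx g *m (g *m kill0 K n) = 1%:M.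
Proof. by rewrite -mulmxA mulKmx // incl_kill. Qed.

Variable I : {mpoly K[n.+1]} -> Prop.
Hypothesis hI : homogeneous_ideal I.
Let I1 := ideal_image g I.

Lemma section_component d : same_ideal
  (ideal_component (ideal_image (g *m kill0 K n) I) d)
  (ideal_image (kill0 K n) (ideal_component I1 d)).
Proof.
move=> f; rewrite (component_image d section_inv hI f) (kill_image _ f).
have E := component_image d (mulVmx Ug) hI.
by split=> -[h /E Ch ->]; exists h.
Qed.

Lemma componentwise_linear_of_section :
  (forall f d, f \is d.-homog -> ideal_component I d (linear_form c * f) -> I f) ->
  componentwise_linear (ideal_image (g *m kill0 K n) I) -> componentwise_linear I.
Proof.
move=> col CL d; have HI := proj1 hI.
have E := component_image d (mulVmx Ug) hI.
have hC := component_homogeneous d I1.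
suff L t : lin t (idmod (proj1 hC)) d.
  have Uig : invmx g \in unitmx by rewrite unitmx_inv.
  have := linear_resolution_image Uig (linear_resolution_of_lin L).
  apply: linear_resolution_same => f.
  rewrite -(ideal_imageK Ug (ideal_component I d) f).
  by split=> -[h /E Ch ->]; exists h.
move: t; apply: lin_of_hyperplane_section; first exact: component_gen_in.
  move=> f hf /E; rewrite -(linear_substVK Ug f) => Cxf.
  apply/E/(ideal_image_mem Ug).
  have hf' : linear_subst (invmx g) f \is d.-homog by exact: linear_subst_homog.
  apply: component_in => //; apply: col hf' _.
  exact/(colon_transport _ (component_ideal d I)).
by move=> t; exact: lin_same_ideal (section_component d) (lin_component (CL d) t).
Qed.

Lemma section_component_linear d : linear_resolution (ideal_component I d) d ->
  eventually_regular (ideal_component I d) c ->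
  (forall k f, (d <= k)%N -> f \is k.-homog ->
     ideal_component I d (linear_form c * f) -> ideal_component I d f) /\
  linear_resolution (ideal_component (ideal_image (g *m kill0 K n) I) d) d.
Proof.
move=> CL [e He].
have E := component_image d (mulVmx Ug) hI.
have hC := component_homogeneous d I1.
have L : forall t, lin t (idmod (proj1 hC)) d.
  have CL1 : linear_resolution (ideal_component I1 d) d.
    by apply: linear_resolution_same (linear_resolution_image Ug CL) => f; split=> /E.
  by move=> t; apply: lin_same_ideal (lin_component CL1 t).
have [|col L0] := hyperplane_section_lin (hJ := hC) L.
  exists e => k f ek hf /E.
  rewrite -(linear_substVK Ug f) => /(colon_transport _ (component_ideal d I)) Cxf.
  apply/E/(ideal_image_mem Ug); apply: He ek _ Cxf; exact: linear_subst_homog.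
split=> [k f dk hf Cxf|].
  apply/(ideal_image_mem Ug)/E; apply: (col k) => //; first exact: linear_subst_homog.
  exact/E/(colon_transport _ (component_ideal d I)).
have hC0 := component_homogeneous d (ideal_image (g *m kill0 K n) I).
apply: (linear_resolution_of_lin (hJ := hC0)) => t.
by apply: lin_same_ideal (L0 t) => f; split=> /section_component.
Qed.

Lemma section_presents_quotient : presents_quotient (linear_form c) (g *m kill0 K n).
Proof.
split=> [h|f].
  exists (linear_subst (incl0 K n *m invmx g) h).
  by rewrite linear_subst_comp section_inv linear_subst_id.
rewrite -linear_subst_comp; split=> [/kill0_eq0[q def_q]|[a ->]]; last first.
  by rewrite !linear_substM cg linear_substZ kill0_ord0 scaler0 mulr0.
exists (linear_subst (invmx g) (lam^-1 *: q)).
apply: (can_inj (linear_substK Ug)); rewrite def_q linear_substM linear_substVK // cg.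
by rewrite -scalerAl -scalerAr scalerA mulVf // scale1r mulrC.
Qed.

End Coordinates.

Lemma pihomog0_const n (a : {mpoly K[n]}) : pihomog mdeg 0 a = (a@_0%MM)%:MP.
Proof.
rewrite (msize1_polyC (p := pihomog mdeg 0 a)).
  congr (_%:MP); rewrite [in RHS](pihomog_partitionE (leqnSn (msize a))) big_ord_recl mcoeffD.
  rewrite [X in _ + X]raddf_sum /= big1 ?addr0 // => i _; apply: (dhomog_nemf_coeff (pihomogP _ _ _)).
  by rewrite /= mdeg0.
rewrite msizeE; apply/bigmax_leqP_seq => m ma _; rewrite ltnS.
by have /= -> := dhomog_mf (pihomogP _ _ _) ma.
Qed.

(** The form is nonzero because [A] has fewer columns than rows, hence a kernel. Adjoining to [A] a
    unit column at a nonzero coefficient of the form gives an invertible matrix. *)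
Lemma presents_quotient_coordinates n (c : 'rV[K]_n.+1) (A : 'M[K]_(n.+1, n)) :
  presents_quotient (linear_form c) A -> exists g lam,
  [/\ g \in unitmx, lam != 0, linear_subst g (linear_form c) = lam *: 'X_ord0 & g *m kill0 K n = A].
Proof.
move=> [_ ker].
have kerA v : v *m A = 0 -> exists l, v = l *: c.
  move=> vA; have /ker[a def_a] : linear_subst A (linear_form v) = 0.
    by rewrite linear_subst_form vA linear_form0.
  exists (a@_0%MM); apply: linear_form_inj.
  have hc := linear_form_homog c.
  rewrite -(pihomog_dE (linear_form_homog v)) def_a (pihomogMr 0 a hc).
  rewrite pihomog0_const mul_mpolyC /linear_form scaler_sumr; apply: eq_bigr => i _.
  by rewrite mxE scalerA.
have c0 : c != 0.
  apply/eqP => c0; have : (\rank (kermx A) <= 0)%N.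
    rewrite leqn0 mxrank_eq0; apply/eqP/row_matrixP => i; rewrite row0.
    have [|l ->] := kerA (row i (kermx A)); first by rewrite -row_mul mulmx_ker row0.
    by rewrite c0 scaler0.
  by rewrite mxrank_ker leqn0 subn_eq0 => /leq_trans/(_ (rank_leq_col A)); rewrite ltnn.
have /rV0Pn[i ci] := c0.
have cA : c *m A = 0.
  apply: linear_form_inj; rewrite -linear_subst_form linear_form0; apply/ker.
  by exists 1; rewrite mul1r.
pose c' : 'M[K]_(n.+1, 1) := delta_mx i 0.
have cc' : c *m c' = (c 0 i)%:M.
  apply/matrixP => a b; rewrite !ord1 !mxE eqxx mulr1n (bigD1 i) //= big1 ?addr0 => [|l li].
    by rewrite mxE !eqxx mulr1.
  by rewrite mxE (negbTE li) mulr0.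
pose g : 'M[K]_n.+1 := (row_mx c' A : 'M_(n.+1, 1 + n)).
exists g, (c 0 i); split=> //.
- rewrite -row_free_unit; apply: inj_row_free => v vg.
  have [e1 e2] : v *m c' = 0 /\ v *m A = 0.
    by apply: eq_row_mx; rewrite -mul_mx_row row_mx0; exact: vg.
  have [l def_v] := kerA v e2; move: e1; rewrite def_v -scalemxAl cc' => /matrixP/(_ 0 0).
  rewrite !mxE eqxx mulr1n => /eqP; rewrite mulf_eq0 (negbTE ci) orbF => /eqP ->.
  by rewrite scale0r.
- rewrite linear_subst_form -linear_form_delta.
  have -> : c *m g = (row_mx (c 0 i)%:M 0 : 'M_(1, 1 + n)).
    by rewrite -cc' -[X in row_mx _ X]cA -mul_mx_row.
  rewrite /linear_form scaler_sumr; apply: eq_bigr => l _.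
  rewrite scalerA; congr (_ *: _); rewrite [in RHS]mxE eqxx /=.
  case: (@split_ordP 1 n l) => a ->.
    by rewrite [LHS]row_mxEl ord1 mxE eqxx mulr1n (_ : _ == _) ?mulr1 //; apply/eqP/val_inj.
  by rewrite [LHS]row_mxEr mxE (_ : (_ == _) = false) ?mulr0.
- by rewrite [LHS](@mul_row_col _ n.+1 1 n n) mulmx0 mulmx1 add0r.
Qed.

Lemma linear_form_coordinates n (c : 'rV[K]_n.+1) : c != 0 -> exists g lam,
  [/\ g \in unitmx, lam != 0 & linear_subst g (linear_form c) = lam *: 'X_ord0].
Proof.
move=> c0; have rc : \rank c = 1%N.
  by apply/eqP; rewrite eqn_leq rank_leq_row lt0n mxrank_eq0.
exists (invmx (row_ebase c)), (col_ebase c 0 0); split.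
- by rewrite unitmx_inv row_ebase_unit.
- by have := col_ebase_unit c; rewrite unitmxE det_mx11 unitfE.
rewrite linear_subst_form -{1}(mulmx_ebase c) mulmxK ?row_ebase_unit // rc -linear_form_delta.
rewrite /linear_form scaler_sumr; apply: eq_bigr => l _; rewrite scalerA.
by congr (_ *: _); rewrite !mxE big_ord1 mxE eqxx /=; congr (_ * _%:R); case: l => [[|l] ?].
Qed.

Lemma componentwise_linear_of_completely_m_full n (I : {mpoly K[n]} -> Prop) :
  homogeneous_ideal I -> completely_m_full I -> componentwise_linear I.
Proof.
elim: n I => [|n IH] I hI.
  move=> /= I0 d; have hC := component_homogeneous d I.
  apply: (linear_resolution_of_lin (hJ := hC)) => t; apply: lin_zero => k v [Cv _] /=.
  by apply/I0; exact: component_sub (proj1 hI) Cv.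
move=> [U [_ [c Uc] /(_ c Uc)[col [A [PQ CM]]]]].
have [g [lam [Ug lam0 cg defA]]] := presents_quotient_coordinates PQ; subst A.
apply: (componentwise_linear_of_section Ug lam0 cg hI); last first.
  by apply: IH => //; exact: ideal_image_homogeneous (section_inv Ug) hI.
move=> f d hf Cxf; apply/col; rewrite /ideal_colon mulrC.
apply: component_succ_in_product Cxf.
by rewrite -(add1n d); apply: dhomogM => //; exact: linear_form_homog.
Qed.

Lemma general_form_regular_components n (I : {mpoly K[n]} -> Prop) : homogeneous_ideal I ->
  exists2 p : {mpoly K[n]}, p != 0 & forall c : 'rV[K]_n, p.@[fun l => c 0 l] != 0 ->
    exists d0, (forall d f, (d0 <= d)%N -> I f -> f \is d.-homog -> ideal_component I d0 f) /\
      forall d, (d <= d0)%N -> eventually_regular (ideal_component I d) c.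
Proof.
move=> hI; have [d0 stab] := ideal_degree_stable hI.
have /fun_choice[p Hp] : forall d, exists p : {mpoly K[n]}, p != 0 /\ forall c : 'rV[K]_n,
    p.@[fun l => c 0 l] != 0 -> eventually_regular (ideal_component I d) c.
  by move=> d; have [p p0 H] := general_form_regular (component_homogeneous d I); exists p.
exists (\prod_(d < d0.+1) p d).
  by rewrite prodf_seq_neq0; apply/allP => d _; case: (Hp d).
move=> c; rewrite rmorph_prod prodf_seq_neq0 => /allP H; exists d0; split=> // d dd0.
have [_] := Hp d; apply; have /= := H (inord d) (mem_index_enum _).
by rewrite inordK.
Qed.

Lemma completely_m_full_of_componentwise_linear n (I : {mpoly K[n]} -> Prop) :
  infinite_field K -> homogeneous_ideal I -> ~ I 1 -> componentwise_linear I ->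
  completely_m_full I.
Proof.
move=> infK; elim: n I => [|n IH] I hI I1 CL.
  have HI := proj1 hI; move=> f /=; split=> [If|->]; last exact: ideal_zero.
  rewrite (nvar0_mpolyC f) in If *; have [->|f0] := eqVneq (f@_0%MM) 0; first by rewrite mpolyC0.
  case: I1; have := ideal_scale HI (f@_0%MM)^-1 If.
  by rewrite -mul_mpolyC -mpolyCM mulVf.
have HI := proj1 hI.
have [p p0 Hp] := general_form_regular_components hI.
(* The factor ['X_ord0] makes the first coefficient of the form, hence the form itself, nonzero. *)
pose q := p * 'X_ord0.
have q0 : q != 0 by rewrite mulf_neq0 // -msize_poly_eq0 msizeX.
exists (fun c => q.@[fun l => c 0 l] != 0); split.
- exists (fun r => r = q) => v; split=> [h|[_ -> //]]; by exists q.
- have [v qv] := mpoly_nonvanishing infK q0; exists (\row_l v l).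
  by rewrite (meval_eq (v2 := v)) // => l; rewrite mxE.
move=> c; rewrite mevalM mulf_eq0 negb_or mevalXU => /andP[/Hp[d0 [stab reg0]] c0].
have [g [lam [Ug lam0 cg]]] : exists g lam,
    [/\ g \in unitmx, lam != 0 & linear_subst g (linear_form c) = lam *: 'X_ord0].
  by apply: linear_form_coordinates; apply: contraNneq c0 => ->; rewrite mxE.
have col0 := section_component_linear Ug lam0 cg hI (CL d0) (reg0 d0 (leqnn d0)).
(* For d > d0, a form of degree at least d lies in I_<d> exactly when it lies in I_<d0>, and there
   the colon condition holds in all degrees from d0 on. *)
have reg d : eventually_regular (ideal_component I d) c.
  have [dd0|d0d] := leqP d d0; first exact: reg0.
  exists d => k f dk hf Cxf; apply: (@component_raise _ _ _ d0 d k) => //; first by lia.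
  apply: (proj1 col0 k) => //; first by lia.
  apply: ideal_gen_min Cxf; first exact: component_ideal.
  by move=> s [Is hs]; apply: (stab d) => //; exact: ltnW.
have sec d := section_component_linear Ug lam0 cg hI (CL d) (reg d).
have hxh k f : pihomog mdeg k.+1 (f * linear_form c) = pihomog mdeg k f * linear_form c.
  by rewrite -(addn1 k) (pihomogMr _ _ (linear_form_homog c)).
split.
  move=> f; split=> [Ixf|If].
    (* Each component f_k is tested separately: x f_k lies in mI and has degree k + 1, hence lies in
       I_<k>, whose colon by x adds nothing in degree k. *)
    rewrite (pihomog_partitionE (leqnn (msize f))); apply: ideal_sum => // k _.
    apply: (component_sub HI (d := k)); apply: (proj1 (sec k) k) => //; first exact: pihomogP.
    by rewrite mulrC -hxh; exact: product_in_component_succ.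
  rewrite /ideal_colon mulrC; apply: ideal_gen_in; exists (linear_form c), f; split=> //.
  by apply: max_ideal_no_constant; apply: (dhomog_nemf_coeff (linear_form_homog c)); rewrite /= mdeg0.
exists (g *m kill0 K n); split; first exact: section_presents_quotient lam0 cg.
apply: IH.
- exact: ideal_image_homogeneous (section_inv Ug) hI.
(* A preimage of 1 has constant term 1, so its component of degree 0 would put 1 in I. *)
- move=> [f If f1]; apply: I1.
  have -> : 1 = pihomog mdeg 0 f; last exact: (proj2 hI).
  have fc : f@_0%MM = 1 by rewrite -(linear_subst_coef0 (g *m kill0 K n)) -f1 mcoeff1 eqxx.
  by rewrite pihomog0_const fc.
- by move=> d; case: (sec d).
Qed.

End Main.

Theorem theorem20 (K : fieldType) (n : nat) (I J : {mpoly K[n]} -> Prop)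
    (K_infinite : infinite_field K)
    (I_homogeneous : homogeneous_ideal I)
    (I_proper : ~ I 1%R)
    (J_gin : is_gin I J)
    (J_stable : stable_ideal J) :
  completely_m_full I <-> componentwise_linear I.
Proof.
split; first exact: componentwise_linear_of_completely_m_full.
exact: completely_m_full_of_componentwise_linear.
Qed.
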